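(* There exist absolute constants $C_1,\theta>0$ (in particular independent of $A,\gamma,\delta$) such that the following holds. Let $A\ge 1$, $\gamma>1$, $\delta\ge 1$, $0\le T_1<T_2\le\infty$, let $x_1,x_2\in\mathbb V$, and let $f_1,f_2:\mathbb R_+\to\mathbb R_+$ satisfy $$\mathbb P_{x_i}(X_t=x_i)\le \frac1{f_i(t)}\qquad\text{for all } t\ge 0,\ i=1,2.$$ If each $f_i$ is $(A,\gamma)$-regular on $[T_1,T_2)$ and satisfies $f_i(t)\le Ae^{\delta t}$ for all $t\in[T_1,T_2)$, then $$\mathbb P_{x_1}(X_t=x_2)\le \frac{C_1A^{\beta}(\nu_{x_2}/\nu_{x_1})^{1/2}}{\sqrt{f_1(\alpha t)f_2(\alpha t)}}\exp\left(-\theta\,\frac{d_\nu(x_1,x_2)^2}{t}\right)\qquad\text{for all } t\in[\widetilde T_1,T_2),\ t>0,$$ where $\alpha=\min\{(2\gamma)^{-1},(64\delta)^{-1}\}$, $\beta=\left\lceil\frac{\log 2}{\log\gamma}\right\rceil$ and $\widetilde T_1=\max\{8\alpha^{-2}T_1^2,\ d_\nu(x_1,x_2)\}$.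
   Context: $\mathbb R_+=[0,\infty)$. $\Gamma=(\mathbb V,\mathbb E)$ is a connected, locally finite graph (finite or infinite) without double edges; $x\sim y$ means $(x,y)\in\mathbb E$. $\mu$ is an edge weight: $\mu_{xy}=\mu_{yx}>0$ if $(x,y)\in\mathbb E$ and $\mu_{xy}=0$ otherwise. $\nu_x>0$ is given for each $x\in\mathbb V$. $X=(X_t)_{t\ge0}$ is the (minimal, i.e. killed at explosion) continuous time random walk on $\mathbb V$ with generator $\mathscr L f(x)=\frac1{\nu_x}\sum_{y\in\mathbb V}(f(y)-f(x))\mu_{xy}$, and $\mathbb P_x$ is its law when started from $x$. $d_\nu$ is a metric on $\mathbb V$ such that $\frac1{\nu_x}\sum_y d_\nu(x,y)^2\mu_{xy}\le 1$ for all $x\in\mathbb V$, and $d_\nu(x,y)\le 1$ whenever $x\sim y$. A function $f:\mathbb R_+\to\mathbb R_+$ is $(A,\gamma)$-regular on $[a,b)$ if it is non-decreasing on all of $\mathbb R_+$ and $\frac{f(\gamma s)}{f(s)}\le A\frac{f(\gamma t)}{f(t)}$ for all $a\le s<t<\gamma^{-1}b$. Conventions: $f$ is positive on $(0,\infty)$; $1/0=+\infty$; if $f(0)=0$, the inequality with $s=0$ is read in cross-multiplied form $f(\gamma s)f(t)\le A f(\gamma t)f(s)$. *)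

(* Defs.v *)
From HB Require Import structures.
From mathcomp Require Import all_boot all_order all_algebra.
From mathcomp Require Import all_classical all_reals all_analysis.
From mathcomp Require Import measurable_realfun.
Set Implicit Arguments.
Unset Strict Implicit.
Unset Printing Implicit Defensive.
Import Order.TTheory GRing.Theory Num.Theory.
Local Open Scope classical_set_scope.
Local Open Scope ring_scope.

Section Graphs.
Context {R : realType} {V : choiceType}.

Definition connected_graph (E : rel V) : Prop :=
  forall x y, exists2 p : seq V, path E x p & last x p = y.

Definition locally_finite (E : rel V) : Prop :=
  forall x, finite_set [set y | E x y].

Definition edge_weight (E : rel V) (mu : V -> V -> R) : Prop :=
  [/\ forall x y, mu x y = mu y x,
      forall x y, E x y -> 0 < mu x y
    & forall x y, ~~ E x y -> mu x y = 0].

(* The sums over [V] below are finitely supported on a locally finite graph. *)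
Definition generator (mu : V -> V -> R) (nu : V -> R) (f : V -> R) (x : V) : R :=
  (nu x)^-1 * \sum_(y \in [set: V]) (f y - f x) * mu x y.

Definition is_metric (D : V -> V -> R) : Prop :=
  [/\ forall x y, 0 <= D x y,
      forall x y, D x y = 0 <-> x = y,
      forall x y, D x y = D y x
    & forall x y z, D x z <= D x y + D y z].

Definition adapted_metric (E : rel V) (mu : V -> V -> R) (nu : V -> R)
    (D : V -> V -> R) : Prop :=
  [/\ is_metric D,
      forall x, (nu x)^-1 * (\sum_(y \in [set: V]) D x y ^+ 2 * mu x y) <= 1
    & forall x y, E x y -> D x y <= 1].

End Graphs.

Section Chains.
Context {R : realType} {V : choiceType}.
Variable L : (V -> R) -> V -> R.

Definition qmat (x y : V) : R := L (fun z => (z == y)%:R) x.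

Definition rate (x : V) : R := - qmat x x.

Definition jump_prob (x y : V) : R :=
  if rate x == 0 then (x == y)%:R
  else if x == y then 0 else qmat x y / rate x.

(* [P x] is the law of the minimal continuous time Markov chain with generator
   [L] started from [x]: the jump chain [Y] is Markov with transition matrix
   [jump_prob] and, given [Y], the holding times [S] are independent, [S k]
   being exponential of parameter [rate (Y k)] (infinite if the rate is 0).
   [None] is a cemetery, where the process is sent at the explosion time
   \sum_k S k. *)
Definition minimal_chain (d : measure_display) (Om : measurableType d)
    (P : V -> probability Om R) (X : R -> Om -> option V) : Prop :=
  exists (Y : nat -> Om -> V) (S : nat -> Om -> \bar R),
  [/\ forall n y, measurable (Y n @^-1` [set y]),
      forall n, measurable_fun [set: Om] (S n),
      forall n w, (0 < S n w)%E,
      forall x n (y : nat -> V) (s : nat -> R), (forall k, 0 <= s k) ->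
        P x [set w | forall k, (k <= n)%N -> Y k w = y k /\ ((s k)%:E < S k w)%E]
        = ((y 0%N == x)%:R * \prod_(k < n) jump_prob (y k) (y k.+1)
            * \prod_(k < n.+1) expR (- (rate (y k) * s k)))%:E
    & forall (t : R) (w : Om) (y : V), 0 <= t ->
        (X t w = Some y <-> exists n, Y n w = y /\
          (\sum_(k < n) S k w <= t%:E < \sum_(k < n.+1) S k w)%E)].

End Chains.

Section Regular.
Context {R : realType}.

(* [f] stands for a function from [0, +oo[ to itself, positive on ]0, +oo[; its
   values at negative reals are irrelevant. *)
Definition nonneg_profile (f : R -> R) : Prop :=
  (forall t : R, 0 <= t -> 0 <= f t) /\ (forall t : R, 0 < t -> 0 < f t).

(* When [f 0 = 0] and [s = 0], the left-hand ratio is 0 since [0^-1 = 0]; the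
   inequality then holds, as does its cross-multiplied form
   f (gamma s) f t <= A f (gamma t) f s. *)
Definition regular (A gamma a : R) (b : \bar R) (f : R -> R) : Prop :=
  (forall s t : R, 0 <= s -> s <= t -> f s <= f t) /\
  (forall s t : R, a <= s -> s < t -> (t%:E < (gamma^-1)%:E * b)%E ->
     f (gamma * s) / f s <= A * (f (gamma * t) / f t)).

End Regular.

(* Main.v *)
Require Import Defs.
From HB Require Import structures.
From mathcomp Require Import all_boot all_order all_algebra.
From mathcomp Require Import finmap.
From mathcomp Require Import all_classical all_reals all_analysis.
From mathcomp Require Import measurable_realfun ring lra.
Set Implicit Arguments.
Unset Strict Implicit.
Unset Printing Implicit Defensive.
Import Order.TTheory GRing.Theory Num.Theory.
Import numFieldNormedType.Exports.
Local Open Scope classical_set_scope.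
Local Open Scope ring_scope.

(** On-diagonal bounds are turned into a Gaussian off-diagonal bound by
Grigor'yan's method, carried out on finite pieces of the graph and with
Davies' exponential weights in place of Gaussian ones.

Let Lambda be a finite set of vertices, let
q_t(x,y) = P_x(X_t = y and X has not left Lambda) / nu_y, and write d for the
distance from x_1 to x_2. The kernel q is symmetric and has the semigroup
property, so that the mass sum_z nu_z q_t(x,z)^2 equals q_2t(x,x), which the
hypothesis bounds by 1 / (nu_x f(2t)). In
q_t(x_1,x_2) = sum_z nu_z q_(t/2)(x_1,z) q_(t/2)(x_2,z) every z is at distance
at least d/2 from x_1 or from x_2. By Cauchy-Schwarz ([heat_off_diagonal]) it
is therefore enough to find a Gaussian bound for the mass of q_(t/2)(x_i,.)
carried by the vertices at distance at least d/2 from x_i.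

For a function psi that is k-Lipschitz for the adapted metric, with k <= 1/2,
the mass weighted by exp(2 psi) grows at most like exp(2 k^2 t)
([weighted_mass_growth]). With psi = k min(d(x,.), b') this bounds the tail
beyond b' at time s by the tail beyond b < b' at an earlier time s', plus
exp(-2k(b'-b)) times the whole mass at time s' ([tail_mass_step]). This
comparison is iterated along the times t/(2 G^j), where G = gamma^beta >= 2,
and along radii that decrease geometrically from d/2 to d/4. Regularity of f
gives f(alpha t) <= E^j f(alpha t / G^j) with
E = A^beta f(G alpha t) / f(alpha t), so the j-th step contributes
E^j / f(alpha t) times a Gaussian factor whose exponent is of order
(9/8)^j d^2/t. If E <= exp(c d^2/t), the Gaussian factors win and the
contributions are summable. If E is larger, no iteration is needed: since
alpha G <= 1, the on-diagonal bound 1/f(t) <= 1/f(G alpha t) is already smaller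
than 1/f(alpha t) by the required factor. The iteration stops at the first
time below d/8; there the comparison is made with the initial Dirac mass and
gives exp(-3d/16), which absorbs the last value of f because of
f(s) <= A exp(delta s). This is where d <= t and the lower bound on t in terms
of T1^2 are needed ([tail_iteration], [gaussian_tail]).

The link with the process is the memoryless property of the holding times: it
gives the increments of t |-> P_x(X_t = y, no exit from Lambda) up to an error
O(h^2) ([killed_prob_increment]), hence the forward equation
([increments_is_derive]). Symmetry and the semigroup property follow from the
equation alone ([heat_semigroup]). Finally Lambda grows through the graph balls
around x_1 and x_2, and P_x1(X_t = x_2) is the limit of the killed
probabilities. *)

(** * Elementary inequalities and derivatives *)

Section Calculus.
Context {R : realType}.
Implicit Types (f g : R -> R) (a b s t x : R).

Lemma is_derive_mul f g t a b : is_derive t 1 f a -> is_derive t 1 g b ->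
  is_derive t 1 (fun s => f s * g s) (a * g t + f t * b).
Proof.
move=> df dg; apply: is_derive_eq (is_deriveM df dg) _.
by rewrite /GRing.scale /= addrC mulrC.
Qed.

Lemma is_derive_scale f t a c : is_derive t 1 f a ->
  is_derive t 1 (fun s => c * f s) (c * a).
Proof. by move=> df; apply: is_derive_eq (is_deriveZ c df) _. Qed.

Lemma is_derive_bigsum (I : Type) (s : seq I) (h : I -> R -> R) (dh : I -> R) t :
  (forall i, is_derive t 1 (h i) (dh i)) ->
  is_derive t 1 (fun u => \sum_(i <- s) h i u) (\sum_(i <- s) dh i).
Proof.
move=> H; elim: s => [|i s ih].
  rewrite big_nil (_ : (fun _ => _) = cst 0); first exact: is_derive_cst.
  by apply/funext => u; rewrite big_nil.
rewrite big_cons (_ : (fun _ => _) = h i + (fun u => \sum_(i <- s) h i u)).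
  exact: is_deriveD.
by apply/funext => u; rewrite big_cons.
Qed.

Lemma is_derive_reflect f x t a : is_derive (x - t) 1 f a ->
  is_derive t 1 (fun s => f (x - s)) (- a).
Proof.
move=> df; have dg : is_derive t 1 (fun s => x - s) (-1).
  apply: is_derive_eq (is_deriveD (is_derive_cst x t 1) (is_deriveNid t 1)) _.
  by rewrite add0r.
have H := @is_derive1_comp R f (fun s => x - s) t a (-1) df dg.
by apply: (is_derive_eq H); rewrite mulrN1.
Qed.

(** With b = a/2, the bounds exp(b) <= 1/(1-b) <= 1 + b + (4/3) b^2, valid for
|b| <= 1/4, and their analogue for -b are squared and added. *)
Lemma expR_add_le a : `|a| <= 1 / 2 -> 2 <= expR a + expR (- a) <= 2 + 2 * a ^+ 2.
Proof.
rewrite ler_norml => /andP[a1 a2].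
pose b := a / 2.
have pq : expR b * expR (- b) = 1 by rewrite -expRD subrr expR0.
have -> : expR a = expR b ^+ 2 by rewrite expr2 -expRD; congr expR; rewrite /b; field.
have -> : expR (- a) = expR (- b) ^+ 2.
  by rewrite expr2 -expRD; congr expR; rewrite /b; field.
have -> : a ^+ 2 = 4 * b ^+ 2 by rewrite /b; field.
have b1 : - (1/4) <= b by rewrite /b; lra.
have b2 : b <= 1/4 by rewrite /b; lra.
have := expR_ge1Dx b; have := expR_ge1Dx (- b).
have := expR_gt0 b; have := expR_gt0 (- b).
move: (expR b) (expR (- b)) pq => p q pq q0 p0 qb pb.
have pU : p <= 1 + b + 4 / 3 * b ^+ 2 by nra.
have qU : q <= 1 - b + 4 / 3 * b ^+ 2 by nra.
apply/andP; split; first by have := sqr_ge0 (p - q); nra.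
have p2 : p ^+ 2 <= (1 + b + 4 / 3 * b ^+ 2) ^+ 2 by rewrite lerXn2r ?nnegrE//; lra.
have q2 : q ^+ 2 <= (1 - b + 4 / 3 * b ^+ 2) ^+ 2 by rewrite lerXn2r ?nnegrE//; lra.
have b4 : b ^+ 2 <= 1 / 16 by nra.
have : b ^+ 2 * b ^+ 2 <= 1 / 16 * b ^+ 2 by rewrite ler_wpM2r// sqr_ge0.
by nra.
Qed.

Lemma one_sub_expRN (a : R) : 0 <= a ->
  a - a ^+ 2 <= 1 - expR (- a) /\ 0 <= 1 - expR (- a) <= a.
Proof.
move=> a0; have e1 := expR_ge1Dx (- a).
have : expR (- a) <= (1 + a)^-1.
  by rewrite expRN lef_pV2 ?posrE ?expR_gt0 ?expR_ge1Dx//; lra.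
have : (1 + a)^-1 <= 1 - a + a ^+ 2.
  rewrite -[leLHS]mul1r ler_pdivrMr; last by lra.
  have := exprn_ge0 3 a0; rewrite !exprS expr0; lra.
have : expR (- a) <= 1 by rewrite expR_le1; lra.
by move=> *; split; [lra|apply/andP; split; lra].
Qed.

Lemma expR1_le4 : expR 1 <= 4 :> R.
Proof.
have -> : expR 1 = expR (1 / 2) ^+ 2 :> R.
  by rewrite expr2 -expRD; congr expR; field.
have e0 := expR_ge1Dx (- (1 / 2) : R).
have e1 : expR (1 / 2) * expR (- (1 / 2)) = 1 :> R by rewrite -expRD subrr expR0.
have e2 := expR_gt0 (1 / 2 : R).
have e3 : expR (1 / 2) <= 2 :> R by nra.
by nra.
Qed.

End Calculus.

Lemma bernoulli_eighth (R : realFieldType) (b : R) (j : nat) :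
  9 / 8 <= b -> 1 + j%:R / 8 <= b ^+ j.
Proof.
move=> b1; elim: j => [|j ih]; first by rewrite mul0r addr0 expr0.
have j0 : 0 <= j%:R :> R by [].
by rewrite exprS -natr1; nra.
Qed.

Lemma weighted_cauchy_schwarz (R : rcfType) (T : finType) (A : pred T)
    (w a b : T -> R) (p q : R) :
  (forall z, 0 <= w z) -> 0 < p -> 0 < q ->
  \sum_(z | A z) w z * a z ^+ 2 <= p -> \sum_(z | A z) w z * b z ^+ 2 <= q ->
  \sum_(z | A z) w z * (a z * b z) <= Num.sqrt p * Num.sqrt q.
Proof.
move=> w0 p0 q0 ap bq.
have sp : 0 < Num.sqrt p by rewrite sqrtr_gt0.
have sq : 0 < Num.sqrt q by rewrite sqrtr_gt0.
have p_ge : p = Num.sqrt p ^+ 2 by rewrite sqr_sqrtr// ltW.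
have qE : q = Num.sqrt q ^+ 2 by rewrite sqr_sqrtr// ltW.
rewrite p_ge in ap; rewrite qE in bq.
move: (Num.sqrt p) (Num.sqrt q) sp sq ap bq => s r s0 r0 ap bq.
apply: (@le_trans _ _ ((r / s * \sum_(z | A z) w z * a z ^+ 2 +
    s / r * \sum_(z | A z) w z * b z ^+ 2) / 2)).
  rewrite !mulr_sumr -big_split/= mulr_suml; apply: ler_sum => z _.
  have -> : (r / s * (w z * a z ^+ 2) + s / r * (w z * b z ^+ 2)) / 2 =
      w z * (a z * b z) + w z * (r * a z - s * b z) ^+ 2 / (2 * (r * s)).
    by field; rewrite !gt_eqF.
  rewrite lerDl; apply: divr_ge0; first by rewrite mulr_ge0 ?sqr_ge0.
  by rewrite ltW// !mulr_gt0.
rewrite ler_pdivrMr//.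
have h1 := ler_wpM2l (ltW (divr_gt0 r0 s0)) ap.
have h2 := ler_wpM2l (ltW (divr_gt0 s0 r0)) bq.
have e1 : r / s * s ^+ 2 = r * s by field; rewrite gt_eqF.
have e2 : s / r * r ^+ 2 = r * s by field; rewrite gt_eqF.
by rewrite e1 in h1; rewrite e2 in h2; lra.
Qed.

(** * Probabilities as real numbers *)

Section RealProbability.
Context {R : realType} {d : measure_display} {Om : measurableType d}.
Variable P : probability Om R.

Definition pr (A : set Om) : R := fine (P A).

Lemma prE A : measurable A -> P A = (pr A)%:E.
Proof. by move=> mA; rewrite fineK// fin_num_measure. Qed.

Lemma pr_ge0 A : 0 <= pr A.
Proof. exact: fine_ge0. Qed.

Lemma pr0 : pr set0 = 0.
Proof. by rewrite /pr measure0. Qed.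

Lemma pr_le1 A : measurable A -> pr A <= 1.
Proof. by move=> mA; rewrite -lee_fin -prE// probability_le1. Qed.

Lemma le_pr A B : measurable A -> measurable B -> A `<=` B -> pr A <= pr B.
Proof.
by move=> mA mB AB; rewrite -lee_fin -!prE// le_measure// inE.
Qed.

Lemma pr_splitI A B : measurable A -> measurable B ->
  pr A = pr (A `&` B) + pr (A `\` B).
Proof.
move=> mA mB; apply: EFin_inj; rewrite EFinD -!prE//.
- by rewrite addeC; exact: measureDI.
- exact: measurableD.
- exact: measurableI.
Qed.

(** This sums an identity over all itineraries of the chain, which form a
countable type. *)
Lemma pr_bigcup_scale (I : countType) (A B : I -> set Om) (c : R) :
  0 <= c -> (forall i, measurable (A i)) -> (forall i, measurable (B i)) ->
  (forall i, B i `<=` A i) ->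
  (forall i j w, A i w -> A j w -> i = j) ->
  (forall i, pr (B i) = c * pr (A i)) ->
  pr (\bigcup_i B i) = c * pr (\bigcup_i A i).
Proof.
move=> c0 mA mB BA dA eqAB.
pose lift (D : I -> set Om) (n : nat) : set Om :=
  if pickle_inv n is Some i then D i else set0.
have liftE D : \bigcup_i D i = \bigcup_n lift D n.
  apply/seteqP; split => w [i _ Di]; last first.
    by move: Di; rewrite /lift; case: pickle_inv => // j Dj; exists j.
  by exists (choice.pickle i) => //; rewrite /lift pickleK_inv.
have mlift D : (forall i, measurable (D i)) -> forall n, measurable (lift D n).
  by move=> mD n; rewrite /lift; case: pickle_inv.
have tlift D : (forall i, D i `<=` A i) -> trivIset setT (lift D).
  move=> DA; apply/trivIsetP => m n _ _ mn; apply/seteqP; split => // w [].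
  rewrite /lift; case Em : (pickle_inv m) => [i|] // Di.
  case En : (pickle_inv n) => [j|] // Dj.
  have ij := dA _ _ _ (DA _ _ Di) (DA _ _ Dj).
  move: (@pickle_invK I m) (@pickle_invK I n); rewrite Em En /= ij => im jn.
  by move: mn; rewrite -im -jn eqxx.
apply: EFin_inj; rewrite EFinM -!prE ?liftE; last 2 first.
- exact: bigcupT_measurable (mlift _ mA).
- exact: bigcupT_measurable (mlift _ mB).
rewrite measure_bigcup; [|by move=> *; exact: mlift|exact: tlift].
rewrite measure_bigcup; [|by move=> *; exact: mlift|by apply: tlift => i w].
rewrite -nneseriesZl; last by move=> *; exact: measure_ge0.
apply: eq_eseriesr => n _; rewrite /lift.
case: pickle_inv => [i|]; last by rewrite !measure0 mule0.
transitivity (pr (B i))%:E; first exact: prE.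
by rewrite eqAB EFinM; congr (_ * _)%E; exact/esym/prE.
Qed.

Lemma pr_setU_le (A B : set Om) : measurable A -> measurable B ->
  pr (A `|` B) <= pr A + pr B.
Proof.
move=> mA mB; rewrite -lee_fin EFinD -!prE//; last exact: measurableU.
exact: measureU2.
Qed.

Lemma pr_bigsetU_le (I : Type) (s : seq I) (B : I -> set Om) :
  (forall i, measurable (B i)) ->
  pr (\big[setU/set0]_(i <- s) B i) <= \sum_(i <- s) pr (B i).
Proof.
move=> mB; elim: s => [|i s ih]; first by rewrite !big_nil pr0.
have mU : measurable (\big[setU/set0]_(i <- s) B i) by exact: bigsetU_measurable.
rewrite !big_cons (le_trans (pr_setU_le _ _))// lerD2l.
exact: ih.
Qed.

Lemma pr_bigsetU_ge (I : finType) (B : I -> set Om) (E : set Om) :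
  (forall i, measurable (B i)) -> measurable E -> (forall i, B i `<=` E) ->
  (forall i j w, B i w -> B j w -> i = j) ->
  \sum_i pr (B i) <= pr E.
Proof.
move=> mB mE BE dB.
suff h (s : seq I) : uniq s ->
    \sum_(i <- s) pr (B i) <= pr (\big[setU/set0]_(i <- s) B i).
  apply: (le_trans (h _ (index_enum_uniq I))); apply: le_pr => //.
    exact: bigsetU_measurable.
  by rewrite -bigcup_seq => w [i _]; exact: BE.
elim: s => [_|i s ih]; first by rewrite !big_nil pr0.
rewrite cons_uniq => /andP[iNs us]; rewrite !big_cons.
have mU : measurable (\big[setU/set0]_(i <- s) B i) by exact: bigsetU_measurable.
rewrite (@pr_splitI (_ `|` _) (B i))//; last exact: measurableU.
rewrite lerD//.
  by apply: le_pr; [|apply: measurableI => //; exact: measurableU|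
    move=> w Bw; split => //; left].
apply: (le_trans (ih us)); apply: le_pr => //.
  by apply: measurableD => //; exact: measurableU.
move=> w Uw; split; first by right.
move: Uw; rewrite -bigcup_seq => -[j /= js Bj] Bi.
by move: iNs; rewrite (dB _ _ _ Bi Bj) js.
Qed.

(** An exponential time S independent of W is still memoryless when it is
observed from the random time W. The range of W is cut into cells of length e,
on which the two sides differ by a factor between exp(-le) and exp(le); then e
tends to 0. Since h and h' play symmetric roles, one inequality suffices. *)
Lemma pr_memoryless (Pi : set Om) (W S : Om -> \bar R) (l t : R) :
  measurable Pi -> measurable_fun [set: Om] W -> measurable_fun [set: Om] S ->
  (forall w, (0 <= W w)%E) -> (forall w, (0 < S w)%E) -> 0 <= l -> 0 <= t ->
  (forall a s : R, 0 <= s ->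
     pr (Pi `&` [set w | (W w <= a%:E)%E] `&` [set w | (s%:E < S w)%E]) =
     expR (- (l * s)) * pr (Pi `&` [set w | (W w <= a%:E)%E])) ->
  forall h h' : R, 0 <= h -> 0 <= h' ->
  expR (l * h) *
    pr (Pi `&` [set w | (W w <= t%:E)%E] `&` [set w | ((t + h)%:E < W w + S w)%E])
  = expR (l * h') *
    pr (Pi `&` [set w | (W w <= t%:E)%E] `&` [set w | ((t + h')%:E < W w + S w)%E]).
Proof.
move=> mPi mW mS W0 S0 l0 t0 indep h h' h0 h'0.
pose A (a : R) := Pi `&` [set w | (W w <= a%:E)%E].
pose U (s : R) := [set w | (s%:E < S w)%E].
pose V (h : R) := [set w | ((t + h)%:E < W w + S w)%E].
have mA a : measurable (A a).
  apply: measurableI => //; rewrite -[X in measurable X]setTI.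
  exact: emeasurable_fun_infty_c.
have mU s : measurable (U s).
  rewrite -[X in measurable X]setTI; exact: emeasurable_fun_o_infty.
have mV k : measurable (V k).
  rewrite -[X in measurable X]setTI; apply: emeasurable_fun_o_infty => //.
  exact: emeasurable_funD.
suff key k k' : 0 <= k -> 0 <= k' ->
    expR (l * k) * pr (A t `&` V k) <= expR (l * k') * pr (A t `&` V k').
  by apply/eqP; rewrite eq_le !key.
move=> {h h' h0 h'0} k0 k'0.
suff grid (N : nat) : expR (l * k) * pr (A t `&` V k) <=
    expR (l * ((t + 1) / N.+1%:R)) * (expR (l * k') * pr (A t `&` V k')).
  have cv : expR (l * ((t + 1) / n.+1%:R)) * (expR (l * k') * pr (A t `&` V k'))
      @[n --> \oo] -->
      expR (l * ((t + 1) * 0)) * (expR (l * k') * pr (A t `&` V k')).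
    apply: cvgMl; apply: continuous_cvg; first exact: continuous_expR.
    by apply: cvgMr; apply: cvgMr; exact: cvg_harmonic.
  rewrite mulr0 mulr0 expR0 mul1r in cv.
  rewrite -(cvg_lim _ cv)//; apply: limr_ge.
    by apply/cvg_ex; eexists; exact: cv.
  by apply: nearW => n; exact: grid.
set e := (t + 1) / N.+1%:R.
have e0 : 0 < e by rewrite divr_gt0// ltr_wpDl.
have eN : N.+1%:R * e = t + 1 by rewrite mulrCA mulfV ?mulr1.
move: e e0 eN => e e0 eN.
(* On a cell, t + h - b < S is implied by, and t + h - a < S implies,
   t + h < W + S. *)
have cell (a b : R) : a <= b -> b <= t -> b - a <= e ->
    expR (l * k) * pr ((A b `\` A a) `&` V k) <=
    expR (l * e) * (expR (l * k') * pr ((A b `\` A a) `&` V k')).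
  move=> ab bt bae.
  have mC : measurable (A b `\` A a) by exact: measurableD.
  have indepC s : 0 <= s ->
      pr ((A b `\` A a) `&` U s) = expR (- (l * s)) * pr (A b `\` A a).
    move=> s0; have sub : A a `<=` A b.
      by move=> w [Pw /= Wa]; split => //=; rewrite (le_trans Wa)// lee_fin.
    have := pr_splitI (mA b) (mA a); rewrite (setIidr sub) => eq1.
    have := pr_splitI (measurableI _ _ (mA b) (mU s)) (mA a).
    rewrite setIAC (setIidr sub) !indep// => eq2.
    have -> : (A b `\` A a) `&` U s = (A b `&` U s) `\` A a.
      by apply/seteqP; split => w [[Aw Bw] Cw]; split => //; split.
    by move: eq2; rewrite -/(A a) -/(A b) eq1 mulrDr => /addrI.
  have up : pr ((A b `\` A a) `&` V k) <= expR (- (l * (t + k - b))) * pr (A b `\` A a).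
    rewrite -indepC; last by rewrite subr_ge0 (le_trans bt)// lerDl.
    apply: le_pr; [exact: measurableI..|].
    move=> w [[[Pw /= Wb] nAa] /= Vw]; split => //=.
    move: Vw; rewrite /V /U /=; case: (S w) (S0 w) => [r||] // r0; last by rewrite ltry.
    case: (W w) Wb (W0 w) => [v||] //; rewrite -?EFinD !lee_fin !lte_fin => *; lra.
  have dn : expR (- (l * (t + k' - a))) * pr (A b `\` A a) <= pr ((A b `\` A a) `&` V k').
    rewrite -indepC; last by rewrite subr_ge0 (le_trans ab)// (le_trans bt)// lerDl.
    apply: le_pr; [exact: measurableI..|].
    move=> w [[[Pw /= Wb] nAa] /= Uw]; split => //=.
    have Wa : (a%:E < W w)%E by rewrite ltNge; apply/negP => ?; apply: nAa.
    move: Uw; rewrite /V /U /=; case: (S w) (S0 w) => [r||] // r0.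
      case: (W w) Wb Wa => [v||] //; rewrite -?EFinD !lee_fin !lte_fin => *; lra.
    by move=> _; case: (W w) (W0 w) => [v||] //= _; rewrite ltry.
  apply: (le_trans (ler_wpM2l (expR_ge0 _) up)).
  apply: (le_trans _
    (ler_wpM2l (expR_ge0 (l * e)) (ler_wpM2l (expR_ge0 (l * k')) dn))).
  rewrite !mulrA -!expRD ler_wpM2r ?pr_ge0// ler_expR.
  have := mulr_ge0 l0 (_ : 0 <= e - (b - a)); rewrite subr_ge0 => /(_ bae).
  by lra.
(* The grid ends at t and starts below 0, where W has no mass. *)
pose x (j : nat) := t - (N.+2%:R - j%:R) * e.
have xt : x N.+2 = t by rewrite /x subrr mul0r subr0.
suff : forall j, (j <= N.+2)%N -> expR (l * k) * pr (A (x j) `&` V k) <=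
    expR (l * e) * (expR (l * k') * pr (A (x j) `&` V k')).
  by move=> /(_ N.+2 (leqnn _)); rewrite xt.
elim=> [_|j ih jN].
  have A0 k1 : A (x 0%N) `&` V k1 = set0.
    apply/seteqP; split => // w [[_ /= Wx] _].
    have := le_trans (W0 w) Wx; rewrite lee_fin /x subr0 leNgt subr_lt0.
    by rewrite -natr1 mulrDl mul1r eN; lra.
  by rewrite !A0 pr0 !mulr0.
have mI1 k1 a : measurable (A a `&` V k1) by exact: measurableI.
have xS : x j.+1 = x j + e by rewrite /x -natr1; ring.
have step k1 : pr (A (x j.+1) `&` V k1) =
    pr (A (x j) `&` V k1) + pr ((A (x j.+1) `\` A (x j)) `&` V k1).
  rewrite (pr_splitI (mI1 k1 _) (mA (x j))); congr (pr _ + pr _).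
    have sub : A (x j) `<=` A (x j.+1).
      move=> w [Pw /= Wa]; split => //=.
      by rewrite (le_trans Wa)// lee_fin xS lerDl ltW.
    by rewrite setIAC (setIidr sub).
  by apply/seteqP; split => w [[Aw Bw] Cw]; split => //; split.
rewrite !step !mulrDr lerD//; first exact: ih (ltnW jN).
apply: cell.
- by rewrite xS lerDl ltW.
- rewrite /x gerDl oppr_le0 mulr_ge0 ?(ltW e0)// subr_ge0 ler_nat//.
- by rewrite xS addrAC subrr add0r.
Qed.

End RealProbability.

(** * Holding times and jump times *)

Section HoldingTimes.
Context {R : realType} {d : measure_display} {Om : measurableType d}.
Variable S : nat -> Om -> \bar R.
Hypothesis mS : forall n, measurable_fun [set: Om] (S n).
Hypothesis S_gt0 : forall n w, (0 < S n w)%E.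

(** The law of the chain is prescribed on these sets; they form a pi-system
that generates the sigma-algebra of the first n holding times. *)
Definition survival_cylinders (n : nat) : set (set Om) :=
  [set A | exists s : nat -> R, (forall k, 0 <= s k) /\
     A = [set w | forall k, (k < n)%N -> ((s k)%:E < S k w)%E]].

Lemma survival_cylinders_setI n : setI_closed (survival_cylinders n).
Proof.
move=> _ _ [s [s0 ->]] [s' [s'0 ->]].
exists (fun k => Num.max (s k) (s' k)); split.
  by move=> k; rewrite le_max s0.
apply/seteqP; split => w /=.
  by move=> [h h'] k kn; rewrite EFin_max gt_max h// h'.
by move=> h; split => k /h; rewrite EFin_max gt_max => /andP[].
Qed.

Lemma survival_cylinders_measurable n : survival_cylinders n `<=` measurable.
Proof.
move=> _ [s [s0 ->]].
rewrite [X in measurable X](_ : _ =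
    \bigcap_(k in `I_n) (setT `&` [set w | ((s k)%:E < S k w)%E])).
  apply: fin_bigcap_measurable => // k _.
  by apply: emeasurable_fun_o_infty.
by apply/seteqP; split => w /= h k kn; [split => //; exact: h|case: (h k kn)].
Qed.

(** Uniqueness of finite measures on a pi-system, in the form used to extend
independence from [survival_cylinders] to every event of the past. *)
Lemma survival_cylinders_unique (P : probability Om R) n (D1 D2 : set Om) (c : R) :
  measurable D1 -> measurable D2 -> 0 <= c ->
  (forall s : nat -> R, (forall k, 0 <= s k) ->
    P (D1 `&` [set w | forall k, (k < n)%N -> ((s k)%:E < S k w)%E]) =
    (c%:E * P (D2 `&` [set w | forall k, (k < n)%N -> ((s k)%:E < S k w)%E]))%E) ->
  forall B, <<s survival_cylinders n >> B ->
    P (D1 `&` B) = (c%:E * P (D2 `&` B))%E.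
Proof.
move=> mD1 mD2 c0 h B sB.
pose m1 := mrestr P mD1; pose m2 := mscale (NngNum c0) (mrestr P mD2).
have -> : P (D1 `&` B) = m1 B by rewrite [D1 `&` B]setIC.
have -> : (c%:E * P (D2 `&` B) = m2 B)%E by rewrite [D2 `&` B]setIC.
apply: (g_sigma_algebra_measure_unique (survival_cylinders n) _ (fun=> setT)) => //.
- exact: survival_cylinders_measurable.
- move=> _; exists (fun=> 0); split => //.
  by apply/esym/seteqP; split => // w _ k _ /=.
- by apply/seteqP; split => // w _; exists 0%N.
- exact: survival_cylinders_setI.
- move=> _ [s [s0 ->]]; rewrite /m1 /m2.
  by rewrite /mscale /= /mrestr setIC h// [X in (_ * P X)%E]setIC.
- move=> _; rewrite /m1 /mrestr (le_lt_trans (probability_le1 _ _)) ?ltry//.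
  exact: measurableI.
Qed.

Definition jump_time (n : nat) (w : Om) : \bar R := (\sum_(k < n) S k w)%E.

Lemma jump_time0 w : jump_time 0 w = 0%E.
Proof. by rewrite /jump_time big_ord0. Qed.

Lemma jump_timeS n w : jump_time n.+1 w = (jump_time n w + S n w)%E.
Proof. by rewrite /jump_time big_ord_recr. Qed.

Lemma jump_time_ge0 n w : (0 <= jump_time n w)%E.
Proof. by apply: sume_ge0 => k _; exact: ltW. Qed.

Lemma jump_time_le m n w : (m <= n)%N -> (jump_time m w <= jump_time n w)%E.
Proof.
move=> /subnKC <-; elim: (n - m)%N => [|k ih]; first by rewrite addn0.
by rewrite addnS jump_timeS (le_trans ih)// leeDl// ltW.
Qed.

Lemma holding_time_measurable_past n k : (k < n)%N ->
  measurable_fun [set: g_sigma_algebraType (survival_cylinders n)] (S k).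
Proof.
move=> kn; apply: (measurability _ (ErealGenOInfty.measurableE R)).
move=> _ [_ [r ->] <-]; rewrite setTI; apply: sub_sigma_algebra.
exists (fun j => if j == k then Num.max 0 r else 0); split.
  by move=> j; case: ifP => // _; rewrite le_max lexx.
apply/seteqP; split => w /=; rewrite in_itv/= andbT.
  move=> rS j _; case: eqP => [->|] //; rewrite EFin_max gt_max rS andbT.
  exact: S_gt0.
by move/(_ k kn); rewrite eqxx EFin_max gt_max => /andP[].
Qed.

Lemma jump_time_measurable_past n k : (k <= n)%N ->
  measurable_fun [set: g_sigma_algebraType (survival_cylinders n)] (jump_time k).
Proof.
move=> kn; elim: k kn => [|k ih] kn.
  rewrite (_ : jump_time 0 = cst 0%E); first exact: measurable_cst.
  by apply/funext => w; rewrite jump_time0.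
rewrite (_ : jump_time k.+1 = (fun w => jump_time k w + S k w)%E); last first.
  by apply/funext => w; rewrite jump_timeS.
apply: emeasurable_funD; first exact: ih (ltnW kn).
exact: holding_time_measurable_past.
Qed.

Lemma jump_time_le_past n k (a : \bar R) : (k <= n)%N ->
  <<s survival_cylinders n >> [set w | (jump_time k w <= a)%E].
Proof.
move=> kn; have := jump_time_measurable_past kn.
move=> /(emeasurable_fun_infty_c (D := setT)) => /(_ (@measurableT _ _) a).
by rewrite setTI.
Qed.

Lemma jump_time_gt_past n k (a : \bar R) : (k <= n)%N ->
  <<s survival_cylinders n >> [set w | (a < jump_time k w)%E].
Proof.
move=> kn; have := jump_time_measurable_past kn.
move=> /(emeasurable_fun_o_infty (D := setT)) => /(_ (@measurableT _ _) a).
by rewrite setTI.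
Qed.

Lemma jump_time_measurable k : measurable_fun [set: Om] (jump_time k).
Proof. exact: emeasurable_sum. Qed.

End HoldingTimes.

(** * The chain killed on leaving a finite set *)

Section JumpChain.
Context {R : realType} {V : choiceType}.
Context {d : measure_display} {Om : measurableType d}.
Variable P : probability Om R.
Variables (Y : nat -> Om -> V) (S : nat -> Om -> \bar R).
Variables (x : V) (r : V -> R) (p : V -> V -> R).
Hypothesis mY : forall n y, measurable (Y n @^-1` [set y]).
Hypothesis mS : forall n, measurable_fun [set: Om] (S n).
Hypothesis S_gt0 : forall n w, (0 < S n w)%E.
Hypothesis r_ge0 : forall y, 0 <= r y.
Hypothesis p_ge0 : forall y z, 0 <= p y z.
Hypothesis law : forall n (y : nat -> V) (s : nat -> R), (forall k, 0 <= s k) ->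
  P [set w | forall k, (k <= n)%N -> Y k w = y k /\ ((s k)%:E < S k w)%E]
  = ((y 0%N == x)%:R * \prod_(k < n) p (y k) (y k.+1)
     * \prod_(k < n.+1) expR (- (r (y k) * s k)))%:E.

Local Notation W := (jump_time S).

Definition follows (n : nat) (y : nat -> V) : set Om :=
  [set w | forall k, (k <= n)%N -> Y k w = y k].

Definition survives (n : nat) (s : R) : set Om := [set w | (s%:E < S n w)%E].

Definition sojourn (n : nat) (t : R) : set Om :=
  [set w | (W n w <= t%:E)%E /\ (t%:E < W n.+1 w)%E].

Lemma follows_measurable n y : measurable (follows n y).
Proof.
rewrite [X in measurable X](_ : _ =
    \bigcap_(k in `I_n.+1) (Y k @^-1` [set y k])).
  by apply: fin_bigcap_measurable => // k _; exact: mY.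
by apply/seteqP; split => w /= h k kn; exact: h.
Qed.

Lemma survives_measurable n s : measurable (survives n s).
Proof.
rewrite -[X in measurable X]setTI; exact: emeasurable_fun_o_infty.
Qed.

Lemma jump_le_measurable n (a : R) : measurable [set w | (W n w <= a%:E)%E].
Proof.
rewrite -[X in measurable X]setTI; apply: emeasurable_fun_infty_c => //.
exact: jump_time_measurable.
Qed.

Lemma jump_gt_measurable n (a : R) : measurable [set w | (a%:E < W n w)%E].
Proof.
rewrite -[X in measurable X]setTI; apply: emeasurable_fun_o_infty => //.
exact: jump_time_measurable.
Qed.

Lemma sojourn_measurable n t : measurable (sojourn n t).
Proof.
by apply: measurableI; [exact: jump_le_measurable|exact: jump_gt_measurable].
Qed.

Lemma past_measurable n B : <<s survival_cylinders S n >> B -> measurable B.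
Proof.
apply: (smallest_sub (@sigma_algebra_measurable _ Om)).
exact: survival_cylinders_measurable.
Qed.

(** On [survival_cylinders] the identity is read off the law of the chain;
[survival_cylinders_unique] extends it to the whole past. The same holds for
[jump_indep]. *)
Lemma holding_time_indep n y (s : R) B : 0 <= s -> <<s survival_cylinders S n >> B ->
  pr P (follows n y `&` survives n s `&` B) =
  expR (- (r (y n) * s)) * pr P (follows n y `&` B).
Proof.
move=> s0 mB; have mf := follows_measurable n y.
have mB' := past_measurable mB; have ms := survives_measurable n s.
apply: EFin_inj; rewrite EFinM -!prE; [|exact: measurableI..|]; last first.
  by apply: measurableI => //; exact: measurableI.
apply: (survival_cylinders_unique mS S_gt0) mB => //; first exact: measurableI.
move=> u u0.
pose v a k := if k == n then a else u k.
have va0 a : 0 <= a -> forall k, 0 <= v a k by move=> a0 k; rewrite /v; case: ifP.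
have vE a : \prod_(k < n.+1) expR (- (r (y k) * v a k)) =
    (\prod_(k < n) expR (- (r (y k) * u k))) * expR (- (r (y n) * a)).
  rewrite big_ord_recr /= /v eqxx; congr (_ * _).
  by apply: eq_bigr => k _; rewrite ltn_eqF.
rewrite [X in P X](_ : _ = [set w | forall k, (k <= n)%N -> Y k w = y k /\
   ((v s k)%:E < S k w)%E]); last first.
  apply/seteqP; split => w /=.
    move=> [[fw sw] uw] k kn; split; first exact: fw.
    by rewrite /v; case: eqP => [->|/eqP nk] //; apply: uw; rewrite ltn_neqAle nk.
  move=> h; split; first split.
  - by move=> k kn; case: (h k kn).
  - by have [_] := h n (leqnn n); rewrite /v eqxx.
  - by move=> k kn; have [_] := h k (ltnW kn); rewrite /v ltn_eqF.
rewrite [X in (_ * P X)%E](_ : _ = [set w | forall k, (k <= n)%N -> Y k w = y k /\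
   ((v 0 k)%:E < S k w)%E]); last first.
  apply/seteqP; split => w /=.
    move=> [fw uw] k kn; split; first exact: fw.
    by rewrite /v; case: eqP => [->|/eqP nk] //; apply: uw; rewrite ltn_neqAle nk.
  move=> h; split.
  - by move=> k kn; case: (h k kn).
  - by move=> k kn; have [_] := h k (ltnW kn); rewrite /v ltn_eqF.
rewrite !law//; [|exact: va0..].
by rewrite !vE mulr0 oppr0 expR0 -EFinM; congr (_%:E); ring.
Qed.

Lemma jump_indep n y (s : R) B : 0 <= s -> <<s survival_cylinders S n.+1 >> B ->
  pr P (follows n.+1 y `&` survives n.+1 s `&` B) =
  p (y n) (y n.+1) * expR (- (r (y n.+1) * s)) * pr P (follows n y `&` B).
Proof.
move=> s0 mB; have mf k := follows_measurable k y.
have mB' := past_measurable mB; have ms := survives_measurable n.+1 s.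
apply: EFin_inj; rewrite EFinM -!prE; [|exact: measurableI..|]; last first.
  by apply: measurableI => //; exact: measurableI.
apply: (survival_cylinders_unique mS S_gt0) mB => //; first exact: measurableI.
  by rewrite mulr_ge0.
move=> u u0.
pose v k := if k == n.+1 then s else u k.
have v0 k : 0 <= v k by rewrite /v; case: ifP.
have vE : \prod_(k < n.+2) expR (- (r (y k) * v k)) =
    (\prod_(k < n.+1) expR (- (r (y k) * u k))) * expR (- (r (y n.+1) * s)).
  rewrite big_ord_recr /= /v eqxx; congr (_ * _).
  by apply: eq_bigr => k _; rewrite ltn_eqF.
rewrite [X in P X](_ : _ = [set w | forall k, (k <= n.+1)%N -> Y k w = y k /\
   ((v k)%:E < S k w)%E]); last first.
  apply/seteqP; split => w /=.
    move=> [[fw sw] uw] k kn; split; first exact: fw.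
    by rewrite /v; case: eqP => [->|/eqP nk] //; apply: uw; rewrite ltn_neqAle nk.
  move=> h; split; first split.
  - by move=> k kn; case: (h k kn).
  - by have [_] := h n.+1 (leqnn _); rewrite /v eqxx.
  - by move=> k kn; have [_] := h k (ltnW kn); rewrite /v ltn_eqF.
rewrite [X in (_ * P X)%E](_ : _ = [set w | forall k, (k <= n)%N -> Y k w = y k /\
   ((u k)%:E < S k w)%E]); last first.
  apply/seteqP; split => w /=.
    by move=> [fw uw] k kn; split; [exact: fw|exact: uw].
  by move=> h; split => k kn; case: (h k kn).
rewrite !law// vE [\prod_(k < n.+1) p _ _]big_ord_recr /= -EFinM.
by congr (_%:E); ring.
Qed.

Lemma follows_stay n y (t h : R) : 0 <= t -> 0 <= h ->
  pr P (follows n y `&` sojourn n t `&` [set w | ((t + h)%:E < W n.+1 w)%E]) =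
  expR (- (r (y n) * h)) * pr P (follows n y `&` sojourn n t).
Proof.
move=> t0 h0.
have indep (a s : R) : 0 <= s ->
    pr P (follows n y `&` [set w | (W n w <= a%:E)%E] `&` [set w | (s%:E < S n w)%E])
    = expR (- (r (y n) * s)) * pr P (follows n y `&` [set w | (W n w <= a%:E)%E]).
  move=> s0; rewrite setIAC; apply: holding_time_indep => //.
  exact: jump_time_le_past.
have := pr_memoryless (follows_measurable n y) (jump_time_measurable mS n) (mS n)
  (jump_time_ge0 S_gt0 n) (S_gt0 n) (r_ge0 (y n)) t0 indep h0 (lexx 0).
have E a : [set w | (a%:E < W n w + S n w)%E] = [set w | (a%:E < W n.+1 w)%E].
  by apply/seteqP; split => w /=; rewrite jump_timeS.
rewrite !E addr0 mulr0 expR0 mul1r => H.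
have -> : follows n y `&` sojourn n t `&` [set w | ((t + h)%:E < W n.+1 w)%E] =
  follows n y `&` [set w | (W n w <= t%:E)%E] `&` [set w | ((t + h)%:E < W n.+1 w)%E].
  apply/seteqP; split => w /= -[].
    by move=> [fw [Ww _]] Vw.
  move=> [fw Ww] Vw; split => //; split => //; split => //.
  by rewrite (le_lt_trans _ Vw)// lee_fin lerDl.
have -> : follows n y `&` sojourn n t =
  follows n y `&` [set w | (W n w <= t%:E)%E] `&` [set w | (t%:E < W n.+1 w)%E].
  by rewrite -setIA; congr (_ `&` _).
by rewrite -H mulrA -expRD addNr expR0 mul1r.
Qed.

Lemma follows_jump n y (t h s : R) : 0 <= t -> 0 <= h -> 0 <= s ->
  pr P (follows n.+1 y `&` survives n.+1 s `&`
        (sojourn n t `&` [set w | (W n.+1 w <= (t + h)%:E)%E])) =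
  p (y n) (y n.+1) * expR (- (r (y n.+1) * s)) * (1 - expR (- (r (y n) * h)))
  * pr P (follows n y `&` sojourn n t).
Proof.
move=> t0 h0 s0; have mfs : measurable (follows n y `&` sojourn n t).
  by apply: measurableI; [exact: follows_measurable|exact: sojourn_measurable].
rewrite jump_indep//; last first.
  apply: (@measurableI _ (g_sigma_algebraType (survival_cylinders S n.+1))).
    apply: (@measurableI _ (g_sigma_algebraType (survival_cylinders S n.+1))).
      exact: jump_time_le_past.
    exact: jump_time_gt_past.
  exact: jump_time_le_past.
rewrite -!mulrA; congr (_ * (_ * _)).
rewrite mulrBl mul1r -follows_stay//.
rewrite (pr_splitI P mfs (jump_gt_measurable n.+1 (t + h))) addrAC subrr add0r.
congr (pr P _); apply/seteqP; split => w /=.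
  move=> [fw [sw Ww]]; split => //.
  by move/(le_lt_trans Ww); rewrite ltxx.
by move=> [[fw sw] Ww]; split => //; split => //; rewrite leNgt; apply/negP.
Qed.

Variables (T : finType) (e : T -> V).
Hypothesis e_inj : injective e.

(** The default value of [nth] is the last position, so that [q] lists only the
positions before it and the itinerary is constant from index [size q] on. *)
Definition itinerary (q : seq T) (z : T) (k : nat) : V := e (nth z q k).

Definition visit (q : seq T) (z : T) (t : R) : set Om :=
  follows (size q) (itinerary q z) `&` sojourn (size q) t.

Definition killed_at (t : R) (z : T) : set Om := \bigcup_q visit q z t.

Definition stays (t h : R) (z : T) : set Om :=
  \bigcup_q (visit q z t `&` [set w | ((t + h)%:E < W (size q).+1 w)%E]).

(** The parameter [s] lets the same events serve the lower bound, with [s = h]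
(no further jump before [t + h]), and the upper bound, with [s = 0]. *)
Definition hops (t h s : R) (z z' : T) : set Om :=
  \bigcup_q (follows (size q).+1 (itinerary (rcons q z) z') `&`
    survives (size q).+1 s `&`
    (sojourn (size q) t `&` [set w | (W (size q).+1 w <= (t + h)%:E)%E])).

Lemma itinerary_rcons q z z' k : (k <= size q)%N ->
  itinerary (rcons q z) z' k = itinerary q z k.
Proof.
move=> kq; rewrite /itinerary nth_rcons; case: ltngtP kq => // [kq|->] _.
  by rewrite (set_nth_default z).
by rewrite nth_default.
Qed.

Lemma itinerary_last q z : itinerary q z (size q) = e z.
Proof. by rewrite /itinerary nth_default. Qed.

Lemma sojourn_unique m n t w : sojourn m t w -> sojourn n t w -> m = n.
Proof.
suff h i j : (i < j)%N -> sojourn i t w -> sojourn j t w -> False.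
  move=> hm hn; case: (ltngtP m n) => // lt.
    by case: (h _ _ lt hm hn).
  by case: (h _ _ lt hn hm).
move=> ij [_ ti] [jt _].
have := lt_le_trans ti (le_trans (jump_time_le S_gt0 w ij) jt).
by rewrite ltxx.
Qed.

Lemma visit_unique q q' z z' t w : visit q z t w -> visit q' z' t w ->
  q = q' /\ z = z'.
Proof.
move=> [fq sq] [fq' sq']; have eqs := sojourn_unique sq sq'.
have E k : (k <= size q)%N -> nth z q k = nth z' q' k.
  move=> kq; apply: e_inj; rewrite -[LHS](fq k kq) -[RHS]fq'//.
  by rewrite -eqs.
have zz' : z = z'.
  by have := E _ (leqnn _); rewrite nth_default// eqs nth_default.
split => //; apply: (@eq_from_nth _ z) => // k kq.
by rewrite E 1?ltnW// zz'.
Qed.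

Lemma itinerary_follows q z z' t w :
  visit q z t w -> Y (size q).+1 w = e z' ->
  follows (size q).+1 (itinerary (rcons q z) z') w.
Proof.
move=> [fq _] Yz' k; rewrite leq_eqVlt => /orP[/eqP ->|kq].
  by rewrite -(size_rcons q z) itinerary_last size_rcons.
by rewrite itinerary_rcons// fq.
Qed.

Lemma hops_visit q z z' w :
  follows (size q).+1 (itinerary (rcons q z) z') w ->
  follows (size q) (itinerary q z) w /\ Y (size q).+1 w = e z'.
Proof.
move=> fq; split; last first.
  by rewrite fq// -(size_rcons q z) itinerary_last.
by move=> k kq; rewrite fq ?leqW// itinerary_rcons.
Qed.

Lemma visit_measurable q z t : measurable (visit q z t).
Proof.
by apply: measurableI; [exact: follows_measurable|exact: sojourn_measurable].
Qed.

Lemma countable_bigcup_measurable (A : seq T -> set Om) :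
  (forall q, measurable (A q)) -> measurable (\bigcup_q A q).
Proof.
move=> mA; apply: countable_bigcupT_measurable => //; exact: countableP.
Qed.

Lemma killed_at_measurable t z : measurable (killed_at t z).
Proof.
by apply: countable_bigcup_measurable => q; exact: visit_measurable.
Qed.

Lemma stays_measurable t h z : measurable (stays t h z).
Proof.
apply: countable_bigcup_measurable => q; apply: measurableI.
  exact: visit_measurable.
exact: jump_gt_measurable.
Qed.

Lemma hops_measurable t h s z z' : measurable (hops t h s z z').
Proof.
apply: countable_bigcup_measurable => q; apply: measurableI.
  by apply: measurableI; [exact: follows_measurable|exact: survives_measurable].
apply: measurableI; first exact: sojourn_measurable.
exact: jump_le_measurable.
Qed.

Lemma pr_stays t h z : 0 <= t -> 0 <= h ->
  pr P (stays t h z) = expR (- (r (e z) * h)) * pr P (killed_at t z).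
Proof.
move=> t0 h0; apply: pr_bigcup_scale => //.
- by move=> q; exact: visit_measurable.
- move=> q; apply: measurableI; first exact: visit_measurable.
  exact: jump_gt_measurable.
- by move=> q q' w vq vq'; have [] := visit_unique vq vq'.
- move=> q; rewrite follows_stay// itinerary_last//.
Qed.

Lemma pr_hops t h s z z' : 0 <= t -> 0 <= h -> 0 <= s ->
  pr P (hops t h s z z') =
  p (e z) (e z') * expR (- (r (e z') * s)) * (1 - expR (- (r (e z) * h)))
  * pr P (killed_at t z).
Proof.
move=> t0 h0 s0; apply: pr_bigcup_scale => //.
- rewrite mulr_ge0 ?mulr_ge0//; rewrite subr_ge0 -expR0 ler_expR oppr_le0.
  by rewrite mulr_ge0.
- by move=> q; exact: visit_measurable.
- move=> q; apply: measurableI.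
    by apply: measurableI; [exact: follows_measurable|exact: survives_measurable].
  apply: measurableI; first exact: sojourn_measurable.
  exact: jump_le_measurable.
- by move=> q w [[fq _] [sq _]]; split => //; have [] := hops_visit fq.
- by move=> q q' w vq vq'; have [] := visit_unique vq vq'.
- move=> q; rewrite follows_jump//.
  rewrite itinerary_rcons// itinerary_last -(size_rcons q z) itinerary_last.
  congr (_ * pr P _).
  apply/seteqP; split => w [fq sq]; split => // k kq.
    by rewrite fq// itinerary_rcons.
  by rewrite fq// itinerary_rcons.
Qed.

Lemma stays_killed_at t h z : 0 <= h -> stays t h z `<=` killed_at (t + h) z.
Proof.
move=> h0 w [q _ [[fq [Wt _]] Wh]]; exists q => //; split => //; split => //.
by rewrite (le_trans Wt)// lee_fin lerDl.
Qed.

Lemma jump_time_fin n w (a : R) : (W n w <= a%:E)%E ->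
  exists2 v : R, W n w = v%:E & 0 <= v <= a.
Proof.
have := jump_time_ge0 S_gt0 n w; case: (W n w) => [v||] //.
by rewrite !lee_fin => v0 va; exists v => //; rewrite v0.
Qed.

Lemma hops_killed_at t h z z' : 0 <= h ->
  hops t h h z z' `<=` killed_at (t + h) z'.
Proof.
move=> h0 w [q _ [[fq sq] [[Wt tW] Wh]]]; exists (rcons q z) => //.
rewrite /visit size_rcons; split => //; split => //.
rewrite jump_timeS; have [v Wv /andP[v0 vh]] := jump_time_fin Wh.
move: sq tW; rewrite /survives /= Wv; case: (S _ w) (S_gt0 (size q).+1 w) => [s||] //.
  by rewrite -EFinD !lte_fin; lra.
by move=> _ _ _; rewrite addey// ltry.
Qed.

Lemma hops_killed t h s z z' : hops t h s z z' `<=` killed_at t z.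
Proof.
by move=> w [q _ [[fq _] [sq _]]]; exists q => //; split => //; have [] := hops_visit fq.
Qed.

Lemma hops_stays_disjoint t h s z z' z'' w :
  hops t h s z z' w -> stays t h z'' w -> False.
Proof.
move=> [q _ [_ [sq Wq]]] [q' _ [[_ sq'] Wq']].
move: Wq'; rewrite -(sojourn_unique sq sq') => /(le_lt_trans Wq).
by rewrite ltxx.
Qed.

Lemma killed_at_unique t z z' w : killed_at t z w -> killed_at t z' w -> z = z'.
Proof. by move=> [q _ vq] [q' _ vq']; have [] := visit_unique vq vq'. Qed.

(** Between [t] and [t + h] there are no jump, one jump, or at least two; in the
last case the holding time after the first jump is at most [h]. *)
Lemma killed_at_split t h y : 0 <= t -> 0 <= h ->
  killed_at (t + h) y `<=` stays t h y `|`
    (\big[setU/set0]_z hops t h 0 z y `|`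
     \big[setU/set0]_(zz : T * T) (hops t h 0 zz.1 zz.2 `\` hops t h h zz.1 zz.2)).
Proof.
move=> t0 h0 w [q _ [fq [Wq qW]]].
have ex : exists n, (t%:E < W n.+1 w)%E.
  by exists (size q); rewrite (le_lt_trans _ qW)// lee_fin lerDl.
(* n is the number of jumps made up to time t. *)
have [n tW nmin] := ex_minnP ex.
have Wt : (W n w <= t%:E)%E.
  case: n tW nmin => [|n] tW nmin; first by rewrite jump_time0 lee_fin.
  by rewrite leNgt; apply/negP => /nmin; rewrite ltnn.
have nq : (n <= size q)%N.
  by apply: nmin; rewrite (le_lt_trans _ qW)// lee_fin lerDl.
have vis : visit (take n q) (nth y q n) t w.
  rewrite /visit size_take_min (minn_idPl nq); split => // k kn.
  rewrite fq ?(leq_trans kn)// /itinerary; congr e.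
  move: kn; rewrite leq_eqVlt => /orP[/eqP->|kn].
    by rewrite [RHS]nth_default// size_take_min (minn_idPl nq).
  rewrite nth_take// (set_nth_default y)//.
  exact: leq_trans kn nq.
have stn : size (take n q) = n by rewrite size_take_min (minn_idPl nq).
move: nq; rewrite leq_eqVlt => /orP[/eqP nq|nq].
  left; exists (take n q) => //; split.
    by move: vis; rewrite [nth y q n]nth_default// nq.
  by rewrite /= stn nq.
have Wn1 : (W n.+1 w <= (t + h)%:E)%E.
  by apply: le_trans Wq; exact: jump_time_le.
have hop : hops t h 0 (nth y q n) (nth y q n.+1) w.
  exists (take n q) => //; split; first split.
  - by apply: itinerary_follows vis _; rewrite stn fq.
  - exact: S_gt0.
  - by rewrite stn; split => //; have [_] := vis; rewrite stn.
right; move: nq; rewrite leq_eqVlt => /orP[/eqP nq|nq].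
  left; rewrite -bigcup_seq; exists (nth y q n) => //=; first exact: mem_index_enum.
  by move: hop; rewrite [nth y q n.+1]nth_default// nq.
right; rewrite -bigcup_seq; exists (nth y q n, nth y q n.+1) => //=.
  exact: mem_index_enum.
split => // -[q' _ [[fq' sq'] [sj' Wq']]].
have := sojourn_unique vis.2 sj'; rewrite stn => En.
have : (W n.+2 w <= (t + h)%:E)%E by apply: le_trans Wq; exact: jump_time_le.
rewrite jump_timeS; move: sq'; rewrite /survives /= -En.
have [v Wv /andP[v0 vh]] := jump_time_fin Wn1.
move: tW; rewrite Wv; case: (S _ w) => [s||] //.
by rewrite -EFinD !lte_fin lee_fin; lra.
Qed.

Definition killed_prob (t : R) (z : T) : R := pr P (killed_at t z).

Lemma killed_prob0 (x0 z : T) : e x0 = x -> killed_prob 0 z = (z == x0)%:R.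
Proof.
move=> ex; rewrite /killed_prob.
have -> : killed_at 0 z =
    [set w | forall k, (k <= 0)%N -> Y k w = e z /\ (0%:E < S k w)%E].
  apply/seteqP; split => w /=.
    move=> [[|a q] _ [fq [Wq _]]]; last first.
      move: Wq; rewrite jump_timeS leNgt => /negP[].
      by rewrite (lt_le_trans (S_gt0 (size q) w))// leeDr// (jump_time_ge0 S_gt0).
    by move=> k; rewrite leqn0 => /eqP ->; split => //; exact: fq.
  move=> h; exists [::] => //; split => /=.
    by move=> k; rewrite leqn0 => /eqP ->; have [] := h 0%N isT.
  by rewrite /sojourn /= jump_timeS !jump_time0 add0e lexx S_gt0.
rewrite /pr (law 0%N (fun=> e z) (s := fun=> 0) (fun=> lexx 0)) big_ord0 mulr1 big_ord1.
by rewrite mulr0 oppr0 expR0 mulr1 -ex (inj_eq e_inj).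
Qed.

Lemma killed_prob_ge0 t z : 0 <= killed_prob t z.
Proof. exact: pr_ge0. Qed.

Lemma killed_prob_le1 t z : killed_prob t z <= 1.
Proof. by apply: pr_le1; exact: killed_at_measurable. Qed.

(** The probability of one jump in a time h is of order h and that of two jumps
of order h^2. The error is uniform in t because the rates are bounded on a
finite set. *)
Lemma killed_prob_increment : exists C : R, forall (t h : R) y, 0 <= t -> 0 <= h ->
  `|killed_prob (t + h) y - killed_prob t y - h *
     (\sum_z killed_prob t z * (r (e z) * p (e z) (e y)) - r (e y) * killed_prob t y)|
  <= C * h ^+ 2.
Proof.
pose K := 1 + \sum_z r (e z) + \sum_z \sum_z' p (e z) (e z').
have sr0 : 0 <= \sum_z r (e z) by apply: sumr_ge0.
have sp0 : 0 <= \sum_z \sum_z' p (e z) (e z').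
  by apply: sumr_ge0 => i _; apply: sumr_ge0.
have Kr z : r (e z) <= K.
  have : r (e z) <= \sum_z r (e z) by rewrite (bigD1 z)//= lerDl sumr_ge0.
  by rewrite /K; lra.
have Kp z z' : p (e z) (e z') <= K.
  have : p (e z) (e z') <= \sum_z' p (e z) (e z').
    by rewrite (bigD1 z')//= lerDl sumr_ge0.
  have : \sum_z' p (e z) (e z') <= \sum_z \sum_z' p (e z) (e z').
    by rewrite [leRHS](bigD1 z)//= lerDl sumr_ge0// => i _; apply: sumr_ge0.
  by rewrite /K; lra.
have K1 : 1 <= K by rewrite /K; lra.
have K0 : 0 <= K by lra.
exists (K ^+ 2 + \sum_(z : T) 2 * K ^+ 3 + \sum_(zz : T * T) K ^+ 3).
move=> t h y t0 h0; have th0 : 0 <= t + h by rewrite addr_ge0.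
pose a z := 1 - expR (- (r (e z) * h)).
have rh0 z : 0 <= r (e z) * h by rewrite mulr_ge0.
have a_lo z : r (e z) * h - (K * h) ^+ 2 <= a z.
  have [lo _] := one_sub_expRN (rh0 z); apply: le_trans lo.
  by rewrite lerB// lerXn2r ?nnegrE ?mulr_ge0// ler_wpM2r.
have a0 z : 0 <= a z by have [_ /andP[]] := one_sub_expRN (rh0 z).
have a_up z : a z <= r (e z) * h by have [_ /andP[]] := one_sub_expRN (rh0 z).
have aK z : a z <= K * h by apply: le_trans (a_up z) _; rewrite ler_wpM2r.
have Kh0 : 0 <= K * h by rewrite mulr_ge0.
have f0 z : 0 <= killed_prob t z := killed_prob_ge0 t z.
have f1 z : killed_prob t z <= 1 := killed_prob_le1 t z.
have staysE : pr P (stays t h y) = (1 - a y) * killed_prob t y.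
  rewrite pr_stays// /a; congr (_ * _); ring.
have hopsE s z z' : 0 <= s -> pr P (hops t h s z z') =
    p (e z) (e z') * expR (- (r (e z') * s)) * a z * killed_prob t z.
  by move=> s0; rewrite pr_hops.
have mh s z z' : measurable (hops t h s z z') by exact: hops_measurable.
have ms z : measurable (stays t h z) by exact: stays_measurable.
have mk u z : measurable (killed_at u z) by exact: killed_at_measurable.
have lower : (1 - a y) * killed_prob t y +
    \sum_z p (e z) (e y) * (1 - a y) * a z * killed_prob t z <= killed_prob (t + h) y.
  pose E := killed_at (t + h) y `\` stays t h y.
  rewrite /killed_prob (pr_splitI P (mk (t + h) y) (ms y)).
  rewrite (setIidr (@stays_killed_at t h y h0)) staysE lerD2l.
  apply: (@le_trans _ _ (\sum_z pr P (hops t h h z y))).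
    by apply: ler_sum => z _; rewrite hopsE// /a opprB addrC subrK.
  apply: pr_bigsetU_ge => //; first exact: measurableD.
    move=> z w hw; split; first exact: hops_killed_at hw.
    by move=> sw; exact: hops_stays_disjoint hw sw.
  move=> z z' w hz hz'.
  exact: (killed_at_unique (hops_killed hz) (hops_killed hz')).
have upper : killed_prob (t + h) y <= (1 - a y) * killed_prob t y +
    (\sum_z p (e z) (e y) * a z * killed_prob t z +
     \sum_(zz : T * T) p (e zz.1) (e zz.2) * a zz.2 * a zz.1 * killed_prob t zz.1).
  have m0 : measurable (\big[setU/set0]_z hops t h 0 z y).
    by apply: bigsetU_measurable.
  have md (zz : T * T) : measurable (hops t h 0 zz.1 zz.2 `\` hops t h h zz.1 zz.2).
    exact: measurableD.
  have m1 : measurable (\big[setU/set0]_(zz : T * T)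
      (hops t h 0 zz.1 zz.2 `\` hops t h h zz.1 zz.2)).
    exact: bigsetU_measurable.
  apply: (le_trans (le_pr P (mk _ _) _ (@killed_at_split t h y t0 h0))) => //.
    by do 2 apply: measurableU => //.
  apply: (le_trans (pr_setU_le _ (ms y) (measurableU _ _ m0 m1))).
  rewrite staysE lerD2l (le_trans (pr_setU_le _ m0 m1))// lerD//.
    apply: (le_trans (pr_bigsetU_le _ _ _)) => //.
    by apply: ler_sum => z _; rewrite hopsE// mulr0 oppr0 expR0 mulr1.
  apply: (le_trans (pr_bigsetU_le _ _ _)) => //.
  apply: ler_sum => -[z z'] _ /=.
  have sub : hops t h h z z' `<=` hops t h 0 z z'.
    move=> w [q _ [[fq sq] Hq]]; exists q => //; split => //; split => //.
    exact: S_gt0.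
  have := pr_splitI P (mh 0 z z') (mh h z z').
  rewrite (setIidr sub) !hopsE// mulr0 oppr0 expR0 mulr1.
  move=> H.
  rewrite -[pr P _](addKr (p (e z) (e z') * expR (- (r (e z') * h)) * a z * killed_prob t z)).
  by rewrite -H /a le_eqVlt; apply/orP; left; apply/eqP; ring.
have pf z z' : 0 <= p (e z) (e z') * killed_prob t z <= K.
  rewrite mulr_ge0//=; apply: le_trans (Kp z z').
  by rewrite -[leRHS]mulr1 ler_wpM2l.
rewrite ler_norml mulrBr mulr_sumr; apply/andP; split.
  rewrite lerNl; apply: (@le_trans _ _ ((\sum_(z : T) 2 * K ^+ 3) * h ^+ 2)); last first.
    rewrite ler_wpM2r ?sqr_ge0// addrAC lerDr addr_ge0 ?sqr_ge0//.
    by apply: sumr_ge0 => i _; rewrite exprn_ge0.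
  have : \sum_z h * (killed_prob t z * (r (e z) * p (e z) (e y))) -
      \sum_z p (e z) (e y) * (1 - a y) * a z * killed_prob t z <=
      (\sum_(z : T) 2 * K ^+ 3) * h ^+ 2.
    rewrite -sumrB mulr_suml; apply: ler_sum => z _.
    have [pf0 pfK] := andP (pf z y).
    have az : r (e z) * h - (1 - a y) * a z <= 2 * (K * h) ^+ 2.
      have : a y * a z <= (K * h) ^+ 2 by rewrite expr2 ler_pM.
      by have := a_lo z; lra.
    have -> : 2 * K ^+ 3 * h ^+ 2 = K * (2 * (K * h) ^+ 2) by ring.
    have -> : h * (killed_prob t z * (r (e z) * p (e z) (e y))) -
      p (e z) (e y) * (1 - a y) * a z * killed_prob t z =
      p (e z) (e y) * killed_prob t z * (r (e z) * h - (1 - a y) * a z) by ring.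
    apply: (le_trans (ler_wpM2l pf0 az)); rewrite ler_wpM2r// mulr_ge0// sqr_ge0//.
  have := ler_wpM2r (f0 y) (a_up y).
  by move: lower; lra.
apply: (@le_trans _ _ ((K ^+ 2 + \sum_(zz : T * T) K ^+ 3) * h ^+ 2)); last first.
  rewrite ler_wpM2r ?sqr_ge0// lerD2r lerDl.
  by apply: sumr_ge0 => i _; rewrite mulr_ge0// exprn_ge0.
have s1 : \sum_z p (e z) (e y) * a z * killed_prob t z <=
    \sum_z h * (killed_prob t z * (r (e z) * p (e z) (e y))).
  apply: ler_sum => z _; have [pf0 _] := andP (pf z y).
  by have := ler_wpM2l pf0 (a_up z); lra.
have s2 : \sum_(zz : T * T) p (e zz.1) (e zz.2) * a zz.2 * a zz.1 * killed_prob t zz.1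
    <= (\sum_(zz : T * T) K ^+ 3) * h ^+ 2.
  rewrite mulr_suml; apply: ler_sum => -[z z'] _ /=.
  have [pf0 pfK] := andP (pf z z').
  have -> : K ^+ 3 * h ^+ 2 = K * ((K * h) * (K * h)) by ring.
  have -> : p (e z) (e z') * a z' * a z * killed_prob t z =
    p (e z) (e z') * killed_prob t z * (a z' * a z) by ring.
  by apply: ler_pM => //; [rewrite mulr_ge0|apply: ler_pM].
have s3 : (r (e y) * h - a y) * killed_prob t y <= K ^+ 2 * h ^+ 2.
  rewrite -exprMn -[leRHS]mulr1; apply: ler_pM => //.
    by rewrite subr_ge0.
  by have := a_lo y; lra.
by rewrite mulrDl; move: upper s1 s2 s3; lra.
Qed.

End JumpChain.

(** * The forward equation *)

Section IncrementsODE.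
Context {R : realType} {T : finType}.
Variables (g : R -> T -> R) (M : T -> T -> R) (C : R).
Hypothesis g_le1 : forall (t : R) z, `|g t z| <= 1.
Hypothesis incr : forall (t h : R) y, 0 <= t -> 0 <= h ->
  `|g (t + h) y - g t y - h * (\sum_z g t z * M z y)| <= C * h ^+ 2.

Let m (t : R) (y : T) : R := \sum_z g t z * M z y.
Let K : R := \sum_y \sum_z `|M z y|.
Let G (t : R) (y : T) : R := g (Num.max t 0) y.

Let K_ge0 : 0 <= K.
Proof. by apply: sumr_ge0 => y _; apply: sumr_ge0. Qed.

Let C_ge0 (y : T) : 0 <= C.
Proof.
have := incr y (lexx 0) ler01; rewrite expr1n mulr1; apply: le_trans.
exact: normr_ge0.
Qed.

Let m_le (y : T) (t : R) : `|m t y| <= K.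
Proof.
rewrite /m (le_trans (ler_norm_sum _ _ _))//.
apply: (@le_trans _ _ (\sum_z `|M z y|)).
  by apply: ler_sum => z _; rewrite normrM ler_piMl.
by rewrite /K [leRHS](bigD1 y)//= lerDl; apply: sumr_ge0 => i _; apply: sumr_ge0.
Qed.

Let g_lip (y : T) (s t : R) : 0 <= s -> s <= t -> t <= s + 1 ->
  `|g t y - g s y| <= (K + C) * (t - s).
Proof.
move=> s0 st ts; have h0 : 0 <= t - s by rewrite subr_ge0.
have := incr y s0 h0; rewrite addrCA subrr addr0 -/(m s y) => I.
have -> : g t y - g s y = (g t y - g s y - (t - s) * m s y) + (t - s) * m s y.
  by rewrite subrK.
apply: (le_trans (ler_normD _ _)); rewrite [leRHS]mulrDl [leRHS]addrC lerD//; last first.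
  by rewrite normrM (ger0_norm h0) mulrC ler_wpM2r.
apply: (le_trans I); rewrite ler_wpM2l ?(C_ge0 y)// expr2 ler_piMr//; lra.
Qed.

Let G_lip (y : T) (s t : R) : `|t - s| <= 1 -> `|G t y - G s y| <= (K + C) * `|t - s|.
Proof.
wlog st : s t / s <= t.
  move=> H ts; have [st|/ltW st] := leP s t; first exact: H.
  by rewrite distrC [ `|t - s|]distrC H// distrC.
rewrite ger0_norm ?subr_ge0// => ts.
have KC : 0 <= K + C by rewrite addr_ge0// (C_ge0 y).
rewrite /G; have [s0|s0] := leP 0 s.
  by rewrite !max_l ?(le_trans s0)// g_lip//; lra.
have [t0|t0] := leP 0 t.
  by rewrite (le_trans (g_lip _ _ _ _))//; [lra|rewrite ler_wpM2l//; lra].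
by rewrite subrr normr0 mulr_ge0// subr_ge0.
Qed.

(** The solution is extended to negative times by its value at 0, which makes it
continuous on the whole line. *)
Lemma increments_continuous (y : T) : continuous (fun t : R => g (Num.max t 0) y).
Proof.
move=> t; apply/cvgrPdist_le => eps eps0; near=> s.
have ts : `|t - s| < Num.min 1 (eps / (K + C + 1)).
  near: s; apply/nbhs_ballP; exists (Num.min 1 (eps / (K + C + 1))) => //=.
  by rewrite lt_min ltr01/= divr_gt0// ltr_wpDl// addr_ge0// (C_ge0 y).
move: ts; rewrite lt_min => /andP[ts1 ts2].
have KC : 0 <= K + C by rewrite addr_ge0// (C_ge0 y).
apply: (le_trans (G_lip _ (ltW ts1))).
move: ts2; rewrite ltr_pdivlMr; last by lra.
by have := normr_ge0 (t - s); nra.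
Unshelve. all: by end_near. Qed.

Let m_lip (y : T) : exists2 C' : R, 0 <= C' & forall s t : R, 0 <= s -> s <= t -> t <= s + 1 ->
  `|m t y - m s y| <= C' * (t - s).
Proof.
exists (\sum_z (K + C) * `|M z y|).
  by apply: sumr_ge0 => z _; rewrite mulr_ge0// addr_ge0// (C_ge0 y).
move=> s t s0 st ts; rewrite /m -sumrB mulr_suml.
apply: (le_trans (ler_norm_sum _ _ _)); apply: ler_sum => z _.
by rewrite -mulrBl normrM mulrAC ler_wpM2r// g_lip.
Qed.

(** The increments are controlled forward in time only; a backward increment
from [t] is a forward one from [t + h] with [h < 0], and the drift is Lipschitz. *)
Lemma increments_is_derive (t : R) (y : T) : 0 < t ->
  is_derive t 1 (fun t : R => g (Num.max t 0) y) (\sum_z g (Num.max t 0) z * M z y).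
Proof.
move=> t0; have [C' C'0 mL] := m_lip y; have C0 := C_ge0 y.
have mt : Num.max t 0 = t by rewrite max_l// ltW.
suff cv : h^-1 *: (G (h *: 1 + t) y - G t y) @[h --> 0^'] --> m t y.
  rewrite mt; split.
    by apply/cvg_ex; exists (m t y).
  by apply/cvg_lim.
apply/cvgrPdist_le => eps eps0; near=> h.
have h0 : h != 0 by near: h; exact: nbhs_dnbhs_neq.
have hs : `|h| < Num.min (Num.min 1 t) (eps / (C + C' + 1)).
  near: h; apply: dnbhs0_lt; rewrite !lt_min ltr01 t0/= divr_gt0//; lra.
move: hs; rewrite !lt_min -andbA => /and3P[h1 ht heps].
have heps' : (C + C') * `|h| <= eps.
  move: heps; rewrite ltr_pdivlMr; last by lra.
  by have := normr_ge0 h; nra.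
rewrite /G mt scaler1; have [hp|hn] := ltP 0 h.
  have := incr y (ltW t0) (ltW hp); rewrite max_l; last by lra.
  rewrite -/(m t y) [h + t]addrC => I.
  have -> : m t y - h^-1 *: (g (t + h) y - g t y) =
      - (h^-1 * (g (t + h) y - g t y - h * m t y)).
    by rewrite /GRing.scale/=; field.
  rewrite normrN normrM normfV (gtr0_norm hp) mulrC ler_pdivrMr//.
  apply: (le_trans I); move: heps'; rewrite (gtr0_norm hp); nra.
have hlt : h < 0 by rewrite lt_neqAle h0.
have nh : `|h| = - h by rewrite ltr0_norm.
rewrite nh in h1 ht heps'.
have s0 : 0 <= t + h by lra.
have nh0 : 0 <= - h by lra.
have := incr y s0 nh0; rewrite addrK max_l; last by lra.
rewrite -/(m (t + h) y) [h + t]addrC => I.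
have L : `|m t y - m (t + h) y| <= C' * (- h).
  have -> : - h = t - (t + h) by ring.
  by apply: mL => //; lra.
have -> : m t y - h^-1 *: (g (t + h) y - g t y) =
   (m t y - m (t + h) y) + h^-1 * (g t y - g (t + h) y - - h * m (t + h) y).
  by rewrite /GRing.scale/=; field.
apply: (le_trans (ler_normD _ _)).
apply: (@le_trans _ _ (C' * - h + C * - h)); last by lra.
rewrite lerD// normrM normfV nh mulrC ler_pdivrMr; last by lra.
by apply: (le_trans I); lra.
Unshelve. all: by end_near. Qed.

End IncrementsODE.

(** * Iterating a tail comparison *)

(** In this section [I b s] stands for the normalized mass beyond distance [b] at
time [s], [Z s] for the whole mass, [G] for the power of gamma that exceeds 2,
and [E] for the growth factor of [f] over a factor [G] of time. The number [X]
is, up to the constant [p], the exponent d^2/t of the conclusion. *)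
Section TailIteration.
Context {R : realType}.
Variables (I : R -> R -> R) (Z f : R -> R) (A G E alpha delta T1 d t X p : R).
Hypothesis I_step : forall s' s b c k : R, 0 <= s' -> s' <= s -> b <= c ->
  0 <= k <= 1 / 2 ->
  I c s <= expR (2 * k ^+ 2 * (s - s')) * (I b s' + expR (- (2 * k * (c - b))) * Z s').
Hypothesis I_init : forall s c k : R, 0 <= s -> 0 <= c -> 0 <= k <= 1 / 2 ->
  I c s <= expR (2 * k ^+ 2 * s - 2 * k * c).
Hypothesis I_ge0 : forall c s : R, 0 <= I c s.
Hypothesis Z_ge0 : forall s : R, 0 <= Z s.
Hypothesis Z_le : forall s : R, 0 < s -> Z s <= (f (2 * s))^-1.
Hypothesis f_gt0 : forall s : R, 0 < s -> 0 < f s.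
Hypothesis f_homo : forall s s' : R, 0 < s -> s <= s' -> f s <= f s'.
Hypothesis f_doubling : forall s : R, T1 <= s -> 0 < s -> s <= alpha * t ->
  f (G * s) <= E * f s.
Hypothesis f_growth : forall s : R, T1 <= s -> 0 < s -> s <= alpha * t ->
  f s <= A * expR (delta * s).
Hypothesis G_ge2 : 2 <= G.
Hypothesis alpha_gt0 : 0 < alpha.
Hypothesis alphaG : alpha * G <= 1.
Hypothesis delta_ge0 : 0 <= delta.
Hypothesis alpha_delta : alpha * delta <= 1 / 64.
Hypothesis d_gt0 : 0 < d.
Hypothesis dt : d <= t.
Hypothesis T1_ge0 : 0 <= T1.
Hypothesis T1_small : 8 * T1 ^+ 2 <= alpha ^+ 2 * t.
Hypothesis A_gt0 : 0 < A.
Hypothesis AE : A <= E.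

Hypothesis p_ge : 256 <= p.
Hypothesis XE : d ^+ 2 = X * (p ^+ 2 * t).
Hypothesis X_gt1 : 1 < X.
Hypothesis E_le : E <= expR X.

(* At step k the radius is rho k, the time is tau k, and f is evaluated at sc k.
   The relation alpha G <= 1 gives sc k <= 2 tau k.+1, so that the mass at time
   tau k.+1 is at most 1 / f (sc k). The number a k is the square of
   rho k - rho k.+1 divided by tau k; it grows at least like (9/8)^k since
   G >= 2. *)
Let tau (k : nat) : R := t / (2 * G ^+ k).
Let sc (k : nat) : R := alpha * t / G ^+ k.
Let rho (k : nat) : R := d / 4 + d / 4 * (3 / 4) ^+ k.
Let a (k : nat) : R := p ^+ 2 / 128 * X * (9 / 16 * G) ^+ k.

Let p_gt0 : 0 < p. Proof. by apply: lt_le_trans p_ge; rewrite ltr0n. Qed.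
Let p2_gt0 : 0 < p ^+ 2. Proof. exact: exprn_gt0. Qed.
Let t_gt0 : 0 < t. Proof. exact: lt_le_trans dt. Qed.
Let G_gt0 : 0 < G. Proof. by apply: lt_le_trans G_ge2. Qed.
Let Gk_gt0 k : 0 < G ^+ k. Proof. exact: exprn_gt0. Qed.
Let tau_gt0 k : 0 < tau k.
Proof. by rewrite divr_gt0// mulr_gt0. Qed.
Let sc_gt0 k : 0 < sc k.
Proof. by rewrite divr_gt0// mulr_gt0. Qed.

Let scS k : G * sc k.+1 = sc k.
Proof. by rewrite /sc exprS; field; rewrite !gt_eqF. Qed.

Let sc_tau k : sc k <= 2 * tau k.+1.
Proof.
have -> : sc k = alpha * G * (2 * tau k.+1).
  by rewrite /sc /tau exprS; field; rewrite !gt_eqF.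
by rewrite ler_piMl// mulr_ge0// ltW.
Qed.

Let sc2 k : sc k = 2 * alpha * tau k.
Proof. by rewrite /sc /tau; field; rewrite gt_eqF. Qed.

Let sc_le k : sc k <= alpha * t.
Proof.
have G1 : 1 <= G ^+ k.
  by apply: exprn_ege1; apply: le_trans G_ge2; rewrite ler1n.
have at0 : 0 <= alpha * t by rewrite mulr_ge0// ltW.
by rewrite /sc ler_pdivrMr//; nra.
Qed.

Let aE k : (d / 16 * (3 / 4) ^+ k) ^+ 2 = a k * tau k.
Proof.
rewrite /a /tau [(d / 16 * _) ^+ 2]exprMn exprAC [(d / 16) ^+ 2]exprMn XE.
have -> : (3 / 4 : R) ^+ 2 = 9 / 16 by field.
rewrite [(9 / 16 * G) ^+ k]exprMn; have := Gk_gt0 k.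
move: (G ^+ k) ((9 / 16) ^+ k) => Gk q Gk0.
by field; rewrite !gt_eqF.
Qed.

Let a_ge0 k : 0 <= a k.
Proof.
have p0 : 0 <= (9 / 16 * G) ^+ k by rewrite exprn_ge0// mulr_ge0// ltW.
have X0 : 0 <= X by rewrite ltW// (lt_trans ltr01).
have p2 : 0 <= p ^+ 2 / 128 by rewrite divr_ge0// ltW.
by rewrite /a mulr_ge0// mulr_ge0.
Qed.

Let aS k : 9 / 8 * a k <= a k.+1.
Proof.
have -> : a k.+1 = 9 / 16 * G * a k by rewrite /a [_ ^+ k.+1]exprS; ring.
by rewrite ler_wpM2r//; move: G_ge2; lra.
Qed.

Let a_ge k : 512 * X * (1 + k%:R / 8) <= a k.
Proof.
have b_ge : 1 + k%:R / 8 <= (9 / 16 * G) ^+ k.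
  by apply: bernoulli_eighth; move: G_ge2; lra.
have k1 : 0 <= 1 + k%:R / 8 :> R by rewrite addr_ge0// divr_ge0.
have X0 : 0 <= X by rewrite ltW// (lt_trans ltr01).
have p2 : 512 <= p ^+ 2 / 128 by move: p_ge; nra.
have h0 : 0 <= 512 :> R by exact: ler0n.
exact: ler_pM (mulr_ge0 h0 X0) k1 (ler_wpM2r X0 p2) b_ge.
Qed.

Let dX : X <= d / p ^+ 2.
Proof.
have p2t : 0 < p ^+ 2 * t by rewrite mulr_gt0.
rewrite -(ler_pM2r p2t) -XE.
have -> : d / p ^+ 2 * (p ^+ 2 * t) = d * t by field; rewrite gt_eqF.
by rewrite expr2 ler_wpM2l// ltW.
Qed.

Let T1_d : T1 <= alpha * d / p.
Proof.
have h : p ^+ 2 * t < d ^+ 2.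
  have p2t : 0 < p ^+ 2 * t by rewrite mulr_gt0.
  by rewrite XE -[ltLHS]mul1r ltr_pM2r.
have ad : 0 <= alpha * d / p by rewrite divr_ge0 ?mulr_ge0 ?ltW.
rewrite -(ler_pXn2r (ltn0Sn 1)) ?nnegrE// expr_div_n ler_pdivlMr// exprMn.
have a2 : 0 <= alpha ^+ 2 by rewrite sqr_ge0.
have h1 := ler_wpM2l a2 (ltW h); have h2 := ler_wpM2l (ltW p2_gt0) T1_small.
have h3 : 0 <= T1 ^+ 2 * p ^+ 2 by rewrite mulr_ge0 ?sqr_ge0.
by move: h1 h2 h3; lra.
Qed.

Let dp_le : d / p <= d / 256.
Proof.
have h : 0 < 256 :> R by rewrite ltr0n.
by rewrite ler_pM2l// lef_pV2 ?posrE.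
Qed.

Let T1_sc k : d / 8 < tau k -> T1 <= sc k.
Proof.
move=> tk; rewrite sc2; apply: (le_trans T1_d).
have h1 : alpha * (d / 8) <= alpha * tau k by rewrite ler_pM2l// ltW.
have h2 := ler_wpM2l (ltW alpha_gt0) dp_le.
have h3 : 0 <= alpha * d by rewrite mulr_ge0// ltW.
by move: h1 h2 h3; lra.
Qed.

Let tau_decr j k : (j <= k)%N -> tau k <= tau j.
Proof.
move=> jk; rewrite /tau ler_pM2l// lef_pV2 ?posrE ?mulr_gt0//.
by rewrite ler_pM2l// ler_weXn2l//; apply: le_trans G_ge2; rewrite ler1n.
Qed.

Let f_chain k : (forall j, (j <= k)%N -> d / 8 < tau j) ->
  f (alpha * t) <= E ^+ k * f (sc k).
Proof.
elim: k => [|k ih] H; first by rewrite expr0 mul1r /sc expr0 divr1.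
have E0 : 0 <= E by apply: (le_trans (ltW A_gt0)).
apply: (le_trans (ih _)); first by move=> j jk; apply: H; exact: leqW.
rewrite exprSr -mulrA ler_wpM2l ?exprn_ge0// -scS.
by apply: f_doubling => //; apply: T1_sc; exact: H.
Qed.

Let fat_gt0 : 0 < f (alpha * t). Proof. by apply: f_gt0; rewrite mulr_gt0. Qed.

(* The Lipschitz constant is (rho k - rho k.+1) / (18 tau k). The growth factor
   is then exp(a k / 162) and the gain is exp(- a k / 9), which beats E^k because
   a k dominates both X and k X. *)
Let one_step k g : (forall j, (j <= k)%N -> d / 8 < tau j) -> 0 <= g ->
  g + a k / 162 <= a k / 18 ->
  expR g * I (rho k) (tau k) <=
  expR (g + a k / 162) * I (rho k.+1) (tau k.+1)
  + (1 / 2) ^+ k * (expR (- X) / f (alpha * t)).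
Proof.
move=> H g0 ga; have tk := H k (leqnn k); have tk0 := tau_gt0 k.
pose Dl := d / 16 * (3 / 4) ^+ k.
have Dl0 : 0 <= Dl by rewrite mulr_ge0 ?exprn_ge0//; move: d_gt0; lra.
have p34 : (3 / 4 : R) ^+ k <= 1 by apply: exprn_ile1; lra.
have Dld : Dl <= d / 16 by rewrite ler_piMr//; move: d_gt0; lra.
have rhoS : rho k - rho k.+1 = Dl by rewrite /rho /Dl exprS; field.
pose kp := Dl / (18 * tau k).
have kp01 : 0 <= kp <= 1 / 2.
  apply/andP; split; first by apply: divr_ge0 => //; rewrite mulr_ge0// ltW.
  rewrite ler_pdivrMr; last by rewrite mulr_gt0.
  by move: Dld tk; lra.
have tt : tau k.+1 <= tau k by exact: tau_decr.
have rr : rho k.+1 <= rho k by rewrite -subr_ge0 rhoS.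
have := I_step (ltW (tau_gt0 k.+1)) tt rr kp01; rewrite rhoS => S1.
have Ea : Dl ^+ 2 = a k * tau k by exact: aE.
have kk : 2 * kp ^+ 2 * (tau k - tau k.+1) <= a k / 162.
  apply: (@le_trans _ _ (2 * kp ^+ 2 * tau k)).
    apply: ler_wpM2l; first by rewrite mulr_ge0// sqr_ge0.
    by have := tau_gt0 k.+1; lra.
  have -> : 2 * kp ^+ 2 * tau k = Dl ^+ 2 / (162 * tau k).
    by rewrite /kp; field; rewrite gt_eqF.
  by rewrite Ea le_eqVlt; apply/orP; left; apply/eqP; field; rewrite gt_eqF.
have kD : 2 * kp * Dl = a k / 9.
  have -> : 2 * kp * Dl = Dl ^+ 2 / (9 * tau k) by rewrite /kp; field; rewrite gt_eqF.
  by rewrite Ea; field; rewrite gt_eqF.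
have Zk : Z (tau k.+1) <= expR (k%:R * X) / f (alpha * t).
  apply: (le_trans (Z_le (tau_gt0 _))).
  rewrite ler_pdivlMr// mulrC ler_pdivrMr; last by rewrite f_gt0// mulr_gt0.
  apply: (le_trans (f_chain H)); apply: ler_pM.
  - by rewrite exprn_ge0// (le_trans (ltW A_gt0)).
  - by rewrite ltW// f_gt0.
  - rewrite expRM_natl lerXn2r ?nnegrE ?expR_ge0//.
    by rewrite (le_trans (ltW A_gt0)).
  - by apply: f_homo => //; exact: sc_tau.
apply: (@le_trans _ _ (expR (g + a k / 162) *
   (I (rho k.+1) (tau k.+1) + expR (- (a k / 9)) * (expR (k%:R * X) / f (alpha * t))))).
  rewrite expRD -mulrA; apply: ler_wpM2l; first exact: expR_ge0.
  apply: (le_trans S1); rewrite kD; apply: ler_pM.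
  - exact: expR_ge0.
  - by rewrite addr_ge0// mulr_ge0// expR_ge0.
  - by rewrite ler_expR.
  - by rewrite lerD2l; apply: ler_wpM2l Zk; exact: expR_ge0.
rewrite mulrDr lerD2l !mulrA -!expRD; apply: ler_wpM2r.
  by rewrite invr_ge0 ltW.
rewrite [leRHS]mulrC; apply: (@le_trans _ _ (expR (- X) * expR (- k%:R))).
  rewrite -expRD ler_expR; have := a_ge k.
  have h1 : k%:R <= k%:R * X by rewrite ler_peMr// ltW.
  by move: ga X_gt1 h1; lra.
apply: ler_wpM2l; first exact: expR_ge0.
have -> : - k%:R = k%:R * -1 :> R by rewrite mulrN1.
rewrite expRM_natl lerXn2r ?nnegrE ?expR_ge0//.
rewrite expRN mul1r lef_pV2 ?posrE ?expR_gt0//.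
by have := expR_ge1Dx (1 : R).
Qed.

(* As a k grows geometrically, the accumulated growth factors are controlled by
   the last one: their exponents sum to at most a k / 18. *)
Let iterate k : (forall j, (j <= k)%N -> d / 8 < tau j) ->
  exists2 g : R, 0 <= g <= a k / 18 &
  I (d / 2) (t / 2) <= expR g * I (rho k.+1) (tau k.+1)
    + (2 - (1 / 2) ^+ k) * (expR (- X) / f (alpha * t)).
Proof.
elim: k => [|k ih] H.
  have a0 := a_ge0 0%N; exists (0 + a 0%N / 162).
    by move: a0; rewrite !add0r => a0; apply/andP; split; lra.
  have := one_step H (lexx 0); rewrite expR0 mul1r => h.
  have -> : d / 2 = rho 0 by rewrite /rho expr0; field.
  have -> : t / 2 = tau 0 by rewrite /tau expr0 mulr1.
  apply: (le_trans (h _)); first by rewrite add0r; move: a0; lra.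
  by rewrite expr0 lerD2l ler_wpM2r ?mulr_ge0 ?invr_ge0 ?expR_ge0 ?(ltW fat_gt0)//; lra.
have [|g /andP[g0 ga] Ig] := ih; first by move=> j jk; apply: H; exact: leqW.
have aS1 := aS k; have ak0 := a_ge0 k; have ak1 := a_ge0 k.+1.
have ga1 : g + a k.+1 / 162 <= a k.+1 / 18 by lra.
exists (g + a k.+1 / 162); first by apply/andP; split; lra.
apply: (le_trans Ig); have := one_step H g0 ga1.
set w := expR (- X) / f (alpha * t) => h.
have -> : (1 / 2 : R) ^+ k = 2 * (1 / 2) ^+ k.+1 by rewrite exprS; field.
lra.
Qed.

Let exists_small_tau : exists k, tau k <= d / 8.
Proof.
pose n := Num.Def.archi_bound (4 * t / d); exists n.
have h : 4 * t / d < n%:R by rewrite archi_boundP// divr_ge0 ?mulr_ge0 ?ltW.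
have h2 : n%:R <= G ^+ n.
  apply: (@le_trans _ _ (2 ^+ n)); last by rewrite lerXn2r ?nnegrE// ltW.
  by rewrite -natrX ler_nat ltnW// ltn_expl.
rewrite /tau ler_pdivrMr ?mulr_gt0//.
move: h; rewrite ltr_pdivrMr// => h.
have := ler_wpM2r (ltW d_gt0) h2.
by lra.
Qed.

(** After K + 1 steps, with tau K.+1 <= d/8 < tau K, the remaining tail is
compared with the Dirac mass at time 0, with Lipschitz constant 1/2. This gives
exp(-3d/16), whereas f (alpha t) and the accumulated growth are at most
exponentials of small multiples of d. The value sc K.+1 may lie below T1, where
f is not controlled, and is then replaced by T1. *)
Lemma tail_iteration :
  I (d / 2) (t / 2) <= 3 * (expR (- X) / f (alpha * t)).
Proof.
have [[|K] tK Kmin] := ex_minnP exists_small_tau.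
  by move: tK; rewrite /tau expr0 mulr1; move: dt d_gt0; lra.
have H j : (j <= K)%N -> d / 8 < tau j.
  by move=> jK; rewrite ltNge; apply/negP => /Kmin; rewrite ltnNge jK.
have [g /andP[g0 ga] Ig] := iterate H; apply: (le_trans Ig).
have pK : 0 <= (1 / 2 : R) ^+ K by rewrite exprn_ge0.
set w := expR (- X) / f (alpha * t).
have w0 : 0 <= w by rewrite mulr_ge0 ?expR_ge0// invr_ge0 ltW.
suff term : expR g * I (rho K.+1) (tau K.+1) <= w.
  have : 0 <= (1 / 2) ^+ K * w by rewrite mulr_ge0.
  by move: term; lra.
have tKd := H K (leqnn K); have tK0 := tau_gt0 K; have tK10 := tau_gt0 K.+1.
have g_small : g <= d / 256 / 2.
  apply: (le_trans ga).
  have p34 : (3 / 4 : R) ^+ K <= 1 by apply: exprn_ile1; lra.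
  have p34' : 0 <= (3 / 4 : R) ^+ K by rewrite exprn_ge0//; lra.
  have Dld : (d / 16 * (3 / 4) ^+ K) ^+ 2 <= (d / 16) ^+ 2.
    rewrite lerXn2r ?nnegrE ?mulr_ge0 ?divr_ge0 ?(ltW d_gt0)//.
    by rewrite ler_piMr// divr_ge0// ltW.
  rewrite aE in Dld; have aK0 := a_ge0 K.
  have h := ler_wpM2l aK0 (ltW tKd); have {h Dld} := le_trans h Dld.
  have -> : (d / 16) ^+ 2 = d / 32 * (d / 8) by field.
  rewrite ler_pM2r ?divr_gt0// => h.
  by move: h d_gt0; lra.
(* K <= G^K <= 4t/d, so E^K costs only a small multiple of d. *)
have KX : K%:R * X <= 4 * d / p ^+ 2.
  have h1 : K%:R * d <= 4 * t.
    have GK : K%:R <= G ^+ K.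
      apply: (@le_trans _ _ (2 ^+ K)); last by rewrite lerXn2r ?nnegrE// ltW.
      by rewrite -natrX ler_nat ltnW// ltn_expl.
    have := ler_wpM2r (ltW d_gt0) GK.
    by move: tKd; rewrite /tau ltr_pdivlMr ?mulr_gt0//; lra.
  have p2t : 0 < p ^+ 2 * t by rewrite mulr_gt0.
  rewrite -(ler_pM2r p2t) -[leLHS]mulrA -XE.
  have -> : 4 * d / p ^+ 2 * (p ^+ 2 * t) = 4 * t * d by field; rewrite gt_eqF.
  by rewrite expr2 mulrA ler_pM2r.
pose s0 := Num.max (sc K.+1) T1.
have s0_gt0 : 0 < s0 by rewrite lt_max sc_gt0.
have T1s0 : T1 <= s0 by rewrite le_max lexx orbT.
have s0_le : s0 <= alpha * t.
  by rewrite ge_max sc_le (le_trans (T1_sc tKd)).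
have ds0 : delta * s0 <= d / 256.
  have [sT|Ts] := leP (sc K.+1) T1.
    rewrite /s0 max_r//; apply: (@le_trans _ _ (delta * (alpha * d / p))).
      exact: ler_wpM2l.
    have -> : delta * (alpha * d / p) = alpha * delta * (d / p) by field; rewrite gt_eqF.
    apply: le_trans dp_le; apply: ler_piMl.
      by rewrite divr_ge0 ?(ltW d_gt0) ?(ltW p_gt0).
    by move: alpha_delta; lra.
  rewrite /s0 max_l; last exact: ltW.
  have -> : delta * sc K.+1 = 2 * (alpha * delta) * tau K.+1 by rewrite sc2; ring.
  have : alpha * delta * tau K.+1 <= 1 / 64 * (d / 8).
    apply: ler_pM => //; last exact: ltW.
    by rewrite mulr_ge0// ltW.
  by lra.
have E0 : 0 <= E by apply: (le_trans (ltW A_gt0)).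
have fU : f (alpha * t) <= expR ((K.+2)%:R * X + d / 256).
  apply: (le_trans (f_chain H)).
  apply: (@le_trans _ _ (E ^+ K * (E * (A * expR (delta * s0))))).
    apply: ler_wpM2l; first exact: exprn_ge0.
    apply: (@le_trans _ _ (f (G * s0))).
      by apply: f_homo => //; rewrite -scS ler_pM2l// le_max lexx.
    apply: (le_trans (f_doubling T1s0 s0_gt0 s0_le)).
    by apply: ler_wpM2l => //; exact: f_growth.
  rewrite expRD expRM_natl !mulrA -exprSr; apply: ler_pM.
  - by rewrite mulr_ge0 ?exprn_ge0// ltW.
  - exact: expR_ge0.
  - rewrite exprSr [leRHS]exprSr; apply: ler_pM.
    + by rewrite mulr_ge0 ?exprn_ge0.
    + exact: ltW.
    + by rewrite -exprSr lerXn2r ?nnegrE ?expR_ge0.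
    + exact: le_trans E_le.
  - by rewrite ler_expR.
have k12 : 0 <= (1 / 2 : R) <= 1 / 2 by rewrite lexx andbT.
have rho0 : d / 4 <= rho K.+1.
  rewrite /rho lerDl mulr_ge0 ?exprn_ge0//; move: d_gt0; lra.
have Iterm : I (rho K.+1) (tau K.+1) <= expR (d / 16 - d / 4).
  apply: (le_trans (I_init (ltW tK10) _ k12)); first by move: rho0 d_gt0; lra.
  by rewrite ler_expR; move: rho0 tK; lra.
rewrite /w ler_pdivlMr//.
apply: (@le_trans _ _ (expR (d / 256 / 2) * expR (d / 16 - d / 4) *
    expR ((K.+2)%:R * X + d / 256))).
  apply: ler_pM; [by rewrite mulr_ge0 ?expR_ge0|exact: ltW| |exact: fU].
  by apply: ler_pM; rewrite ?expR_ge0// ler_expR.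
rewrite -!expRD ler_expR.
have e2 : (K.+2)%:R * X = K%:R * X + 2 * X by rewrite -addn2 natrD mulrDl.
have dpp : d / p ^+ 2 <= d / 256 / 256.
  have -> : d / p ^+ 2 = d / p / p by field; rewrite gt_eqF.
  have h : 0 < 256 :> R by rewrite ltr0n.
  apply: ler_pM; [by rewrite divr_ge0 ?ltW|by rewrite invr_ge0 ltW|exact: dp_le|].
  by rewrite lef_pV2 ?posrE.
have e3 : 4 * d / p ^+ 2 = 4 * (d / p ^+ 2) by field; rewrite gt_eqF.
by move: KX dX dpp d_gt0; rewrite e2 e3; lra.
Qed.

End TailIteration.

Section RegularProfiles.
Context {R : realType}.

(** The ratio f(gamma^n s) / f(s) telescopes, and each factor is compared with
the corresponding one for u. *)
Lemma regular_iter (A gamma T1 t : R) (T2 : \bar R) (f : R -> R) (s u : R) n :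
  0 <= A -> 1 < gamma -> nonneg_profile f -> regular A gamma T1 T2 f ->
  T1 <= s -> 0 < s -> s < u -> gamma ^+ n * u <= t -> (t%:E < T2)%E ->
  f (gamma ^+ n * s) * f u <= A ^+ n * f (gamma ^+ n * u) * f s.
Proof.
move=> A0 g1 [f0 fpos] [_ freg] T1s s0 su + tT2.
have g0 : 0 < gamma by exact: lt_trans ltr01 g1.
have u0 : 0 < u by exact: lt_trans su.
elim: n => [|n ih] nut; first by rewrite !expr0 !mul1r mulrC.
have gn0 : 0 < gamma ^+ n by exact: exprn_gt0.
have gn1 : 1 <= gamma ^+ n by apply: exprn_ege1; exact: ltW.
have nu0 : 0 < gamma ^+ n * u by rewrite mulr_gt0.
have ns0 : 0 < gamma ^+ n * s by rewrite mulr_gt0.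
have ut : gamma ^+ n * u <= t.
  by apply: le_trans nut; rewrite exprS -mulrA ler_peMl// ltW.
have dom : ((gamma ^+ n * u)%:E < (gamma^-1)%:E * T2)%E.
  case: T2 tT2 {freg} => [b||] //; last by rewrite gt0_muley ?ltry// lte_fin invr_gt0.
  rewrite lte_fin -EFinM lte_fin [_ * b]mulrC ltr_pdivlMr// => tb.
  by apply: le_lt_trans tb; rewrite mulrC mulrA -exprS.
have T1n : T1 <= gamma ^+ n * s by rewrite (le_trans T1s)// ler_peMl// ltW.
have nsu : gamma ^+ n * s < gamma ^+ n * u by rewrite ltr_pM2l.
have := freg _ _ T1n nsu dom; rewrite !mulrA -!exprS.
rewrite ler_pdivrMr ?fpos// mulrAC ler_pdivlMr ?fpos//.
move: ih => /(_ ut) ih H.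
rewrite -(ler_pM2r (fpos _ nu0)) mulrAC.
apply: (le_trans (ler_wpM2r (ltW (fpos _ u0)) H)).
have c0 : 0 <= A * f (gamma ^+ n.+1 * u).
  by rewrite mulr_ge0// f0// mulr_ge0 ?exprn_ge0// ltW.
have := ler_wpM2l c0 ih; rewrite [A ^+ n.+1]exprS; lra.
Qed.

(** The exponent beta is the least n for which gamma^n >= 2; minimality gives
gamma^beta <= 2 gamma, hence alpha gamma^beta <= 1. *)
Lemma doubling_exponent (gamma : R) : 1 < gamma ->
  exists n : nat, [/\ Num.ceil (ln 2 / ln gamma) = n.+1 :> int,
    2 <= gamma ^+ n.+1 & gamma ^+ n.+1 <= 2 * gamma].
Proof.
move=> g1; have g0 : 0 < gamma by exact: lt_trans ltr01 g1.
have lg0 : 0 < ln gamma by rewrite ln_gt0.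
have l2 : 0 < ln 2 :> R by rewrite ln_gt0// ltr1n.
have q0 : 0 < ln 2 / ln gamma by rewrite divr_gt0.
have : (0 < Num.ceil (ln 2 / ln gamma))%R by rewrite ceil_gt0.
case E : (Num.ceil (ln 2 / ln gamma)) => [[|n]|n] // _.
have /andP[] := ceil_itv (ln 2 / ln gamma).
have -> : (Num.ceil (ln 2 / ln gamma) - 1)%:~R = n%:R :> R.
  by rewrite E -addn1 PoszD addrK -pmulrn.
rewrite E -pmulrn ltr_pdivlMr// ler_pdivrMr// -ltr_expR -ler_expR.
rewrite !expRM_natl !lnK ?posrE// => lo up; exists n; split => //.
by rewrite exprSr ler_pM2r// ltW.
Qed.

(** Let F = f(G alpha t) / f(alpha t) and B = A^beta. If exp(X) <= 4 B^2 F, the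
bound 1/f(t) <= 1 / (F f(alpha t)) is good enough. Otherwise X > 1 and
B F <= exp(X), and [tail_iteration] applies. *)
Lemma gaussian_tail (I : R -> R -> R) (Z f : R -> R)
    (A gamma delta T1 d t p : R) (T2 : \bar R) :
  let alpha := Num.min (2 * gamma)^-1 (64 * delta)^-1 in
  let beta : int := Num.ceil (ln 2 / ln gamma) in
  (forall s' s b c k : R, 0 <= s' -> s' <= s -> b <= c -> 0 <= k <= 1 / 2 ->
    I c s <= expR (2 * k ^+ 2 * (s - s')) * (I b s' + expR (- (2 * k * (c - b))) * Z s')) ->
  (forall s c k : R, 0 <= s -> 0 <= c -> 0 <= k <= 1 / 2 ->
    I c s <= expR (2 * k ^+ 2 * s - 2 * k * c)) ->
  (forall c s, 0 <= I c s) -> (forall s, 0 <= Z s) ->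
  (forall c s, I c s <= Z s) ->
  (forall s : R, 0 < s -> Z s <= (f (2 * s))^-1) ->
  nonneg_profile f -> regular A gamma T1 T2 f ->
  (forall s : R, T1 <= s -> (s%:E < T2)%E -> f s <= A * expR (delta * s)) ->
  1 <= A -> 1 < gamma -> 1 <= delta -> 0 <= T1 -> 256 <= p ->
  0 <= d -> d <= t -> 0 < t -> 8 * alpha ^- 2 * T1 ^+ 2 <= t -> (t%:E < T2)%E ->
  I (d / 2) (t / 2) <=
    4 * (A ^ beta) ^+ 2 * expR (- (d ^+ 2 / (p ^+ 2 * t))) / f (alpha * t).
Proof.
move=> alpha beta I_step I_init I0 Z0 IZ Zf [f0 fpos] freg fgrow A1 g1 del1 T10 p_ge.
move=> d0 dt t0 T1t tT2.
have [n [bE G2 G2g]] := doubling_exponent g1.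
rewrite /beta bE -exprnP; set B := A ^+ n.+1; set G := gamma ^+ n.+1 in G2 G2g.
have A0 : 0 < A by lra.
have g0 : 0 < gamma by lra.
have p0 : 0 < p by apply: lt_le_trans p_ge; rewrite ltr0n.
have alpha0 : 0 < alpha by rewrite lt_min !invr_gt0 !mulr_gt0//; lra.
have alG : alpha * G <= 1.
  apply: (@le_trans _ _ ((2 * gamma)^-1 * (2 * gamma))).
    by apply: ler_pM; [exact: ltW|lra|rewrite ge_min lexx|].
  by rewrite mulVf// gt_eqF// mulr_gt0.
have ald : alpha * delta <= 1 / 64.
  apply: (@le_trans _ _ ((64 * delta)^-1 * delta)).
    by apply: ler_pM; [exact: ltW|lra|rewrite ge_min lexx orbT|].
  rewrite invfM -mulrA mulVf ?mulr1 ?div1r//; lra.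
have al1 : alpha <= 1.
  by have := alG; have : alpha * 2 <= alpha * G by [rewrite ler_pM2l]; lra.
have at0 : 0 < alpha * t by rewrite mulr_gt0.
have at_t : alpha * t <= t by rewrite ler_piMl// ltW.
have Gat_t : G * (alpha * t) <= t.
  by rewrite mulrA [G * _]mulrC ler_piMl// ltW.
have fmono (s s' : R) : 0 < s -> s <= s' -> f s <= f s'.
  by move=> s0; apply: freg.1; exact: ltW.
have atG : alpha * t <= G * (alpha * t) by rewrite ler_peMl ?(ltW at0)//; lra.
set fa := f (alpha * t); have fa0 : 0 < fa by exact: fpos.
pose F := f (G * (alpha * t)) / fa.
have fG0 : 0 < f (G * (alpha * t)) by apply: lt_le_trans (fmono _ _ at0 atG).
have F1 : 1 <= F by rewrite /F ler_pdivlMr// mul1r; exact: fmono.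
have B1 : 1 <= B by exact: exprn_ege1.
have AB : A <= B.
  by rewrite /B exprS ler_peMr ?(ltW A0)//; exact: exprn_ege1.
set X := d ^+ 2 / (p ^+ 2 * t).
have X0 : 0 <= X by rewrite divr_ge0 ?sqr_ge0// mulr_ge0 ?sqr_ge0// ltW.
have BB : B <= B ^+ 2 by rewrite expr2 ler_peMl//; lra.
have [triv|nontriv] := leP (expR X) (4 * B ^+ 2 * F).
  have t20 : 0 < t / 2 by rewrite divr_gt0.
  apply: (le_trans (IZ _ _)); apply: (le_trans (Zf _ t20)).
  have -> : 2 * (t / 2) = t by field.
  apply: (@le_trans _ _ (F * fa)^-1).
    rewrite lef_pV2 ?posrE ?fpos//; last by rewrite mulr_gt0// divr_gt0.
    by rewrite /F divfK ?gt_eqF//; apply: fmono => //; exact: lt_le_trans atG.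
  rewrite invfM ler_pM2r ?invr_gt0// -[leLHS]mul1r ler_pdivrMr; last by lra.
  by rewrite expRN mulrAC ler_pdivlMr ?expR_gt0// mul1r.
have F0 : 0 < F by lra.
have BF : B * F <= B ^+ 2 * F by rewrite ler_pM2r.
have BF1 : 1 <= B * F by rewrite -[leLHS]mulr1; apply: ler_pM.
have X1 : 1 < X.
  rewrite -ltr_expR; apply: (le_lt_trans expR1_le4); apply: le_lt_trans nontriv.
  by rewrite -mulrA ler_peMr//; lra.
have dpos : 0 < d.
  rewrite lt_neqAle d0 andbT; apply/eqP => dE; move: X1.
  by rewrite /X -dE expr0n mul0r ltr10.
have p2t : 0 < p ^+ 2 * t by rewrite mulr_gt0 ?exprn_gt0.
have XE : d ^+ 2 = X * (p ^+ 2 * t) by rewrite /X divfK// gt_eqF.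
have fdouble (s : R) : T1 <= s -> 0 < s -> s <= alpha * t -> f (G * s) <= B * F * f s.
  move=> T1s s0; rewrite le_eqVlt => /predU1P[->|sat].
    rewrite -/fa -mulrA; have -> : F * fa = f (G * (alpha * t)) by rewrite /F divfK ?gt_eqF.
    by rewrite ler_peMl// ltW.
  have := regular_iter (ltW A0) g1 (conj f0 fpos) freg T1s s0 sat Gat_t tT2.
  rewrite -/G -/B -/fa => h; rewrite /F mulrA mulrAC ler_pdivlMr//.
have T1sm : 8 * T1 ^+ 2 <= alpha ^+ 2 * t.
  have a2 : 0 < alpha ^+ 2 by rewrite exprn_gt0.
  by move: T1t; rewrite mulrAC ler_pdivrMr// [t * _]mulrC.
have fgr (s : R) : T1 <= s -> 0 < s -> s <= alpha * t -> f s <= A * expR (delta * s).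
  move=> T1s s0 sat; apply: fgrow => //; apply: le_lt_trans tT2.
  by rewrite lee_fin (le_trans sat).
have AE : A <= B * F by rewrite (le_trans AB)// ler_peMr//; lra.
have EX : B * F <= expR X.
  apply: (le_trans BF); apply: ltW; apply: le_lt_trans nontriv.
  by rewrite -mulrA ler_peMl//; [rewrite mulr_ge0 ?sqr_ge0// ltW|lra].
have del0 : 0 <= delta by lra.
have := tail_iteration I_step I_init I0 Z0 Zf fpos fmono fdouble fgr G2 alpha0 alG
  del0 ald dpos dt T10 T1sm A0 AE p_ge XE X1 EX.
move=> /le_trans; apply; rewrite -/fa !mulrA ler_pM2r ?invr_gt0// ler_pM2r ?expR_gt0//.
have : 1 <= B ^+ 2 by exact: le_trans BB.
lra.
Qed.

End RegularProfiles.

(** * Heat kernels on a finite set *)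

(** Here [c] is the conductance inside the finite set and [r] the total jump rate;
[c_row] allows [r] to exceed the rate inside the set, which is how killing at
the boundary enters. The function [u x t] is the density, with respect to [nu],
of the killed walk started at [x]. *)
Section FiniteHeat.
Context {R : realType} {T : finType}.
Variables (nu r : T -> R) (c D : T -> T -> R) (u : T -> R -> T -> R).
Hypothesis nu_gt0 : forall y, 0 < nu y.
Hypothesis c_ge0 : forall y z, 0 <= c y z.
Hypothesis c_sym : forall y z, c y z = c z y.
Hypothesis c_row : forall y, \sum_z c y z <= nu y * r y.
Hypothesis c_adapted : forall y, \sum_z c y z * D y z ^+ 2 <= nu y.
Hypothesis c_range : forall y z, 0 < c y z -> D y z <= 1.
Hypothesis D_sym : forall y z, D y z = D z y.
Hypothesis D_ge0 : forall y z, 0 <= D y z.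
Hypothesis D_refl : forall y, D y y = 0.
Hypothesis D_tri : forall x y z, D x z <= D x y + D y z.
Hypothesis u_ge0 : forall x t y, 0 <= u x t y.
Hypothesis u_cont : forall x y, continuous (fun t : R => u x t y).
Hypothesis u_derive : forall x (t : R) y, 0 < t ->
  is_derive t 1 (fun t : R => u x t y)
    ((nu y)^-1 * (\sum_z c y z * u x t z) - r y * u x t y).
Hypothesis u_init : forall x y, u x 0 y = (x == y)%:R / nu x.

(** By symmetry of [c], the function s |-> sum_z u_(t-s)(x,z) u_s(y,z) nu_z has
derivative 0. Its value at 0 is u_t(x,y). *)
Lemma heat_semigroup x y (s t : R) : 0 <= s -> s <= t ->
  \sum_z u x (t - s) z * u y s z * nu z = u x t y.
Proof.
move=> s0 st.
pose phi (s : R) := \sum_z nu z * (u x (t - s) z * u y s z).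
pose du (x : T) (t : R) (z : T) :=
  (nu z)^-1 * (\sum_z' c z z' * u x t z') - r z * u x t z.
have dphi v : v \in `]0, s[%R -> is_derive v 1 phi 0.
  rewrite in_itv/= => /andP[v0 vs].
  have tv0 : 0 < t - v by lra.
  have H : is_derive v 1 phi (\sum_z
      nu z * (- du x (t - v) z * u y v z + u x (t - v) z * du y v z)).
    apply: is_derive_bigsum => z; apply: is_derive_scale; apply: is_derive_mul.
      exact: (is_derive_reflect (u_derive x z tv0)).
    exact: u_derive.
  apply: (is_derive_eq H).
  rewrite (eq_bigr (fun z => (\sum_z' c z z' * (u x (t - v) z * u y v z')) -
     \sum_z' c z z' * (u x (t - v) z' * u y v z))).
    rewrite sumrB [X in X - _]exchange_big/= -sumrB big1// => z _.
    rewrite -sumrB big1// => z' _; rewrite c_sym; ring.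
  move=> z _; rewrite /du.
  have nz : nu z != 0 by rewrite gt_eqF.
  rewrite [X in _ = X - _](_ : _ = u x (t - v) z * \sum_z' c z z' * u y v z').
    rewrite [X in _ = _ - X](_ : _ = u y v z * \sum_z' c z z' * u x (t - v) z').
      by field.
    by rewrite mulr_sumr; apply: eq_bigr => z' _; ring.
  by rewrite mulr_sumr; apply: eq_bigr => z' _; ring.
have cphi : {within `[0, s], continuous phi}.
  apply: continuous_subspaceT => v.
  apply: cvg_big => [|z _]; first exact: add_continuous.
  apply: cvgMr; apply: cvgM; last exact: u_cont.
  apply: (@cvg_comp _ _ _ (fun v => t - v) (fun w => u x w z)); last exact: u_cont.
  by apply: cvgB; [exact: cvg_cst|exact: cvg_id].
have [_ _] := MVT_segment s0 dphi cphi.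
rewrite mul0r => /eqP; rewrite subr_eq0 => /eqP E.
transitivity (phi s); first by apply: eq_bigr => z _; ring.
rewrite E /phi (bigD1 y)//= subr0 u_init eqxx big1 ?addr0.
  by have ny : nu y != 0 by [rewrite gt_eqF]; rewrite mulrCA mul1r divff ?mulr1.
by move=> z zy; rewrite u_init eq_sym (negbTE zy) !mul0r !mulr0.
Qed.

Definition weighted_mass (psi : T -> R) (x : T) (t : R) : R :=
  \sum_y nu y * expR (2 * psi y) * u x t y ^+ 2.

(** After symmetrization the Dirichlet form gives, for every edge,
v_y v_z (w_y + w_z) - v_y^2 w_y - v_z^2 w_z with w = exp(2 psi). With
a = psi y - psi z this is at most (cosh a - 1) times v_y^2 w_y + v_z^2 w_z, and
cosh a - 1 <= a^2 <= k^2 D(y,z)^2. Summation over z and the adaptedness of the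
metric end the proof; killing only helps. *)
Lemma weighted_mass_dissipation (psi v : T -> R) (k : R) : 0 <= k <= 1 / 2 ->
  (forall y z, `|psi y - psi z| <= k * D y z) ->
  \sum_y expR (2 * psi y) * (2 * v y * (\sum_z c y z * v z - nu y * r y * v y))
  <= 2 * k ^+ 2 * \sum_y nu y * expR (2 * psi y) * v y ^+ 2.
Proof.
move=> /andP[k0 k1] psiL.
pose w y := expR (2 * psi y); pose m y := w y * v y ^+ 2.
have w0 y : 0 < w y := expR_gt0 _.
have m0 y : 0 <= m y by rewrite mulr_ge0 ?sqr_ge0// ltW.
apply: (@le_trans _ _ (\sum_y \sum_z c y z * (2 * w y * (v y * v z - v y ^+ 2)))).
  apply: ler_sum => y _; rewrite -/(w y).
  have -> : \sum_z c y z * (2 * w y * (v y * v z - v y ^+ 2)) =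
      2 * w y * v y * (\sum_z c y z * v z) - 2 * m y * (\sum_z c y z).
    rewrite !mulr_sumr -sumrB; apply: eq_bigr => z _; rewrite /m; ring.
  have := ler_wpM2l (m0 y) (c_row y); rewrite /m; lra.
have sym : \sum_y \sum_z c y z * (2 * w y * (v y * v z - v y ^+ 2)) =
   \sum_y \sum_z c y z * (v y * v z * (w y + w z) - m y - m z).
  have E : \sum_y \sum_z c y z * (w y * (v y * v z - v y ^+ 2)) =
      \sum_y \sum_z c y z * (w z * (v y * v z - v z ^+ 2)).
    rewrite exchange_big/=; apply: eq_bigr => y _; apply: eq_bigr => z _.
    by rewrite c_sym; ring.
  transitivity (\sum_y \sum_z c y z * (w y * (v y * v z - v y ^+ 2)) +
    \sum_y \sum_z c y z * (w y * (v y * v z - v y ^+ 2))).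
    rewrite -big_split/=; apply: eq_bigr => y _; rewrite -big_split/=.
    by apply: eq_bigr => z _; ring.
  rewrite {2}E -big_split/=; apply: eq_bigr => y _; rewrite -big_split/=.
  by apply: eq_bigr => z _; rewrite /m; ring.
rewrite {}sym.
apply: (@le_trans _ _ (\sum_y \sum_z (k ^+ 2 * (c y z * D y z ^+ 2) * m y +
    k ^+ 2 * (c y z * D y z ^+ 2) * m z))).
  apply: ler_sum => y _; apply: ler_sum => z _.
  have := c_ge0 y z; rewrite le_eqVlt => /predU1P[<-|c0]; first by lra.
  have D1 := c_range c0; have D0 := D_ge0 y z; have pL := psiL y z.
  have pa : `|psi y - psi z| <= 1 / 2 by apply: (le_trans pL); nra.
  have /andP[h2 hU] := expR_add_le pa.
  have a2 : (psi y - psi z) ^+ 2 <= k ^+ 2 * D y z ^+ 2.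
    by rewrite -exprMn -(real_normK (num_real (psi y - psi z))) lerXn2r ?nnegrE ?mulr_ge0.
  set H := expR (psi y - psi z) + expR (- (psi y - psi z)) in h2 hU.
  have wE y' : w y' = expR (psi y') ^+ 2.
    by rewrite /w expr2 -expRD; congr expR; ring.
  have wH : w y + w z = expR (psi y) * expR (psi z) * H.
    rewrite /H mulrDr -!expRD /w; congr (expR _ + expR _); ring.
  rewrite [leRHS](_ : _ = c y z * (k ^+ 2 * D y z ^+ 2 * (m y + m z))); last by ring.
  rewrite ler_pM2l// wH.
  pose a := v y * expR (psi y); pose b := v z * expR (psi z).
  have -> : m y = a ^+ 2 by rewrite /m wE /a; ring.
  have -> : m z = b ^+ 2 by rewrite /m wE /b; ring.
  have -> : v y * v z * (expR (psi y) * expR (psi z) * H) = a * b * H.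
    by rewrite /a /b; ring.
  set q := (psi y - psi z) ^+ 2 in hU a2.
  have ab : 2 * (a * b) <= a ^+ 2 + b ^+ 2 by have := sqr_ge0 (a - b); nra.
  have ab0 : 0 <= a ^+ 2 + b ^+ 2 by rewrite addr_ge0 ?sqr_ge0.
  have : 2 * (a * b) * H <= (a ^+ 2 + b ^+ 2) * H by apply: ler_wpM2r; lra.
  have : (a ^+ 2 + b ^+ 2) * H <= (a ^+ 2 + b ^+ 2) * (2 + 2 * q) by rewrite ler_wpM2l.
  have : (a ^+ 2 + b ^+ 2) * q <= (a ^+ 2 + b ^+ 2) * (k ^+ 2 * D y z ^+ 2).
    by rewrite ler_wpM2l.
  lra.
have E : \sum_y \sum_z k ^+ 2 * (c y z * D y z ^+ 2) * m z =
    \sum_y \sum_z k ^+ 2 * (c y z * D y z ^+ 2) * m y.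
  rewrite exchange_big/=; apply: eq_bigr => y _; apply: eq_bigr => z _.
  by rewrite c_sym D_sym.
under eq_bigr do rewrite big_split/=.
rewrite big_split/= E -mulr2n -[leLHS]mulr_natl -mulrA ler_wpM2l// mulr_sumr.
apply: ler_sum => y _; rewrite -mulr_suml -mulr_sumr -mulrA ler_wpM2l ?sqr_ge0//.
rewrite -[nu y * _ * _]mulrA -/(m y) ler_wpM2r//.
Qed.

Lemma weighted_mass_growth (psi : T -> R) (k : R) x (s t : R) : 0 <= k <= 1 / 2 ->
  (forall y z, `|psi y - psi z| <= k * D y z) -> 0 <= s -> s <= t ->
  weighted_mass psi x t <= expR (2 * k ^+ 2 * (t - s)) * weighted_mass psi x s.
Proof.
move=> k01 psiL s0 st.
pose f (t : R) := expR (- (2 * k ^+ 2) * t) * weighted_mass psi x t.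
pose du (t : R) (z : T) :=
  (nu z)^-1 * (\sum_z' c z z' * u x t z') - r z * u x t z.
pose dm (v : R) := \sum_y nu y * expR (2 * psi y) * (du v y * u x v y + u x v y * du v y).
have df v : v \in `]s, t[%R -> is_derive v 1 f
    (- (2 * k ^+ 2) * expR (- (2 * k ^+ 2) * v) * weighted_mass psi x v +
     expR (- (2 * k ^+ 2) * v) * dm v).
  rewrite in_itv/= => /andP[sv vt]; apply: is_derive_mul.
    have H := @is_derive1_comp R expR (fun v => - (2 * k ^+ 2) * v) v _ _
      (is_derive_expR _) (is_derive_scale (- (2 * k ^+ 2)) (is_derive_id v 1)).
    by apply: (is_derive_eq H); ring.
  apply: is_derive_bigsum => y; apply: is_derive_scale.
  have v0 : 0 < v by lra.
  exact: (is_derive_mul (u_derive x y v0) (u_derive x y v0)).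
have cf : {within `[s, t], continuous f}.
  apply: continuous_subspaceT => v; apply: cvgM.
    apply: (@cvg_comp _ _ _ (fun v => - (2 * k ^+ 2) * v) expR).
      by apply: cvgMr; exact: cvg_id.
    exact: continuous_expR.
  apply: cvg_big => [|z _]; first exact: add_continuous.
  by apply: cvgMr; apply: cvgM; exact: u_cont.
have [v _] := MVT_segment st df cf.
have : dm v <= 2 * k ^+ 2 * weighted_mass psi x v.
  apply: le_trans (weighted_mass_dissipation (u x v) k01 psiL).
  rewrite le_eqVlt; apply/orP; left; apply/eqP; apply: eq_bigr => y _; rewrite /du.
  by have ny : nu y != 0 by [rewrite gt_eqF]; field.
move=> dmU E.
have fts : f t <= f s.
  rewrite -subr_le0 E mulr_le0_ge0//; last by rewrite subr_ge0.
  have := ler_wpM2l (expR_ge0 (- (2 * k ^+ 2) * v)) dmU; lra.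
have := ler_wpM2l (expR_ge0 (2 * k ^+ 2 * t)) fts; rewrite /f !mulrA -!expRD.
rewrite mulNr subrr expR0 mul1r => /le_trans; apply.
by rewrite le_eqVlt; apply/orP; left; apply/eqP; congr (expR _ * _); ring.
Qed.

Definition total_mass (x : T) (s : R) : R := nu x * \sum_y nu y * u x s y ^+ 2.

Definition tail_mass (x : T) (b s : R) : R :=
  nu x * \sum_(y | b <= D x y) nu y * u x s y ^+ 2.

Lemma mass_term_ge0 x s y : 0 <= nu y * u x s y ^+ 2.
Proof. by rewrite mulr_ge0 ?sqr_ge0// ltW. Qed.

Lemma total_mass_ge0 x s : 0 <= total_mass x s.
Proof.
by rewrite /total_mass mulr_ge0 ?(ltW (nu_gt0 x))// sumr_ge0// => y _; exact: mass_term_ge0.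
Qed.

Lemma tail_mass_ge0 x b s : 0 <= tail_mass x b s.
Proof.
by rewrite /tail_mass mulr_ge0 ?(ltW (nu_gt0 x))// sumr_ge0// => y _; exact: mass_term_ge0.
Qed.

Lemma tail_mass_le x b s : tail_mass x b s <= total_mass x s.
Proof.
rewrite /tail_mass /total_mass ler_pM2l// [leRHS](bigID (fun y => b <= D x y))/= lerDl.
by apply: sumr_ge0 => y _; exact: mass_term_ge0.
Qed.

Lemma total_mass_diag x s : 0 <= s -> total_mass x s = nu x * u x (2 * s) x.
Proof.
move=> s0; rewrite /total_mass; congr (_ * _).
have s2 : s <= 2 * s by lra.
rewrite -(heat_semigroup x x s0 s2); apply: eq_bigr => y _.
have -> : 2 * s - s = s by ring.
by ring.
Qed.

(* Truncation at b makes the weight constant on the tail beyond b. *)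
Let truncated (x : T) (k b : R) (y : T) : R := k * Num.min (D x y) b.

Let truncated_lip x k b y z : 0 <= k ->
  `|truncated x k b y - truncated x k b z| <= k * D y z.
Proof.
move=> k0; rewrite /truncated -mulrBr normrM (ger0_norm k0) ler_wpM2l//.
have h1 := D_tri x y z; have h2 := D_tri x z y; rewrite [D z y]D_sym in h2.
have h3 := D_ge0 y z; rewrite ler_norml.
by case: (leP (D x y) b) => ?; case: (leP (D x z) b) => ?; apply/andP; split; lra.
Qed.

Let tail_le_weighted x k b s : 0 <= k ->
  expR (2 * k * b) * tail_mass x b s <=
  nu x * weighted_mass (truncated x k b) x s.
Proof.
move=> k0; rewrite /tail_mass mulrCA ler_pM2l// /weighted_mass.
rewrite [leRHS](bigID (fun y => b <= D x y))/= -[leLHS]addr0; apply: lerD.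
  rewrite mulr_sumr; apply: ler_sum => y byx.
  by rewrite /truncated min_r// le_eqVlt; apply/orP; left; apply/eqP; rewrite mulrA; ring.
by apply: sumr_ge0 => y _; rewrite !mulr_ge0 ?sqr_ge0 ?expR_ge0// ltW.
Qed.

Lemma tail_mass_step x (s' s b b' k : R) : 0 <= s' -> s' <= s -> b <= b' ->
  0 <= k <= 1 / 2 ->
  tail_mass x b' s <= expR (2 * k ^+ 2 * (s - s')) *
    (tail_mass x b s' + expR (- (2 * k * (b' - b))) * total_mass x s').
Proof.
move=> s'0 s's bb' k12; have /andP[k0 _] := k12.
have e0 := expR_gt0 (2 * k * b').
rewrite -(ler_pM2l e0); apply: (le_trans (tail_le_weighted x b' s k0)).
have g := weighted_mass_growth x k12 (fun y z => truncated_lip x b' y z k0) s'0 s's.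
apply: (le_trans (ler_wpM2l (ltW (nu_gt0 x)) g)).
rewrite mulrCA [leRHS]mulrCA ler_pM2l ?expR_gt0// mulrDr [X in _ + X]mulrA -expRD.
have -> : 2 * k * b' + - (2 * k * (b' - b)) = 2 * k * b by ring.
rewrite /tail_mass /total_mass [in leRHS]mulrCA [X in _ + X]mulrCA -mulrDr ler_pM2l//.
rewrite /weighted_mass [leLHS](bigID (fun y => b <= D x y))/= lerD//.
  rewrite mulr_sumr; apply: ler_sum => y _.
  rewrite [leRHS]mulrCA [leRHS]mulrA ler_wpM2r ?sqr_ge0//.
  apply: ler_wpM2l; first exact: ltW.
  rewrite ler_expR.
  by rewrite /truncated -mulrA ler_pM2l// ler_wpM2l// ge_min lexx orbT.
rewrite mulr_sumr [leRHS](bigID (fun y => b <= D x y))/= -[leLHS]add0r lerD//.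
  by apply: sumr_ge0 => y _; rewrite mulr_ge0 ?expR_ge0// mass_term_ge0.
apply: ler_sum => y; rewrite -ltNge => yb.
rewrite [leRHS]mulrCA [leRHS]mulrA ler_wpM2r ?sqr_ge0//.
apply: ler_wpM2l; first exact: ltW.
rewrite ler_expR.
by rewrite /truncated -mulrA ler_pM2l// ler_wpM2l// ge_min (ltW yb).
Qed.

(** The initial mass sits at distance 0, where the weight is 1. *)
Lemma tail_mass_init x (s b k : R) : 0 <= s -> 0 <= b -> 0 <= k <= 1 / 2 ->
  tail_mass x b s <= expR (2 * k ^+ 2 * s - 2 * k * b).
Proof.
move=> s0 b0 k12; have /andP[k0 _] := k12.
have e0 := expR_gt0 (2 * k * b).
rewrite -(ler_pM2l e0); apply: (le_trans (tail_le_weighted x b s k0)).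
have g := weighted_mass_growth x k12 (fun y z => truncated_lip x b y z k0) (lexx 0) s0.
apply: (le_trans (ler_wpM2l (ltW (nu_gt0 x)) g)).
rewrite subr0 -expRD addrC subrK mulrCA -[leRHS]mulr1 ler_pM2l ?expR_gt0//.
rewrite /weighted_mass (bigD1 x)//= big1 ?addr0.
  rewrite /truncated D_refl min_l// mulr0 mulr0 expR0 mulr1 u_init eqxx.
  have nx : nu x != 0 by rewrite gt_eqF.
  by rewrite le_eqVlt; apply/orP; left; apply/eqP; rewrite mul1r; field.
by move=> y yx; rewrite u_init eq_sym (negbTE yx) mul0r expr0n mulr0.
Qed.

(** Each z is at distance at least D x1 x2 / 2 from x1 or from x2. *)
Lemma heat_off_diagonal x1 x2 (t P1 P2 Q1 Q2 : R) : 0 < t ->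
  0 < P1 -> 0 < P2 -> 0 < Q1 -> 0 < Q2 ->
  tail_mass x1 (D x1 x2 / 2) (t / 2) <= P1 ->
  tail_mass x2 (D x1 x2 / 2) (t / 2) <= P2 ->
  total_mass x1 (t / 2) <= Q1 -> total_mass x2 (t / 2) <= Q2 ->
  nu x2 * u x1 t x2 <= Num.sqrt (nu x2 / nu x1) *
    (Num.sqrt P1 * Num.sqrt Q2 + Num.sqrt Q1 * Num.sqrt P2).
Proof.
move=> t0 P10 P20 Q10 Q20 tP1 tP2 tQ1 tQ2.
have n1 := nu_gt0 x1; have n2 := nu_gt0 x2.
have th0 : 0 <= t / 2 by lra.
have tht : t / 2 <= t by lra.
pose a := u x1 (t / 2); pose b := u x2 (t / 2); pose h := D x1 x2 / 2.
have uE : u x1 t x2 = \sum_z nu z * (a z * b z).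
  rewrite -(heat_semigroup x1 x2 th0 tht); apply: eq_bigr => z _.
  have -> : t - t / 2 = t / 2 by field.
  by rewrite mulrC.
have split_sum : u x1 t x2 <= \sum_(z | h <= D x1 z) nu z * (a z * b z) +
    \sum_(z | h <= D x2 z) nu z * (a z * b z).
  rewrite uE [X in _ <= X + _]big_mkcond [X in _ <= _ + X]big_mkcond -big_split/=.
  apply: ler_sum => z _.
  have t0' : 0 <= nu z * (a z * b z).
    by apply: mulr_ge0; [exact: ltW|apply: mulr_ge0; exact: u_ge0].
  case: (leP h (D x1 z)) => [_|h1]; first by case: ifP => _; lra.
  case: (leP h (D x2 z)) => [_|h2]; first by rewrite add0r.
  have := D_tri x1 z x2; rewrite [D z x2]D_sym; move: h1 h2; rewrite /h; lra.
have nz z : 0 <= nu z by exact: ltW.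
have norm_le x (A : pred T) (v : T -> R) (Q : R) :
    nu x * \sum_(z | A z) nu z * v z ^+ 2 <= Q ->
    \sum_(z | A z) nu z * v z ^+ 2 <= Q / nu x.
  by move=> hQ; rewrite ler_pdivlMr// mulrC.
have sub_le (A : pred T) (v : T -> R) : \sum_(z | A z) nu z * v z ^+ 2 <=
    \sum_z nu z * v z ^+ 2.
  rewrite [leRHS](bigID A)/= lerDl; apply: sumr_ge0 => y _.
  by rewrite mulr_ge0 ?sqr_ge0.
have C1 : \sum_(z | h <= D x1 z) nu z * (a z * b z) <=
    Num.sqrt (P1 / nu x1) * Num.sqrt (Q2 / nu x2).
  apply: weighted_cauchy_schwarz; rewrite ?divr_gt0//; first exact: norm_le.
  exact: le_trans (sub_le (fun z => h <= D x1 z) b) (norm_le x2 predT b Q2 tQ2).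
have C2 : \sum_(z | h <= D x2 z) nu z * (a z * b z) <=
    Num.sqrt (Q1 / nu x1) * Num.sqrt (P2 / nu x2).
  apply: weighted_cauchy_schwarz; rewrite ?divr_gt0//; last exact: norm_le.
  exact: le_trans (sub_le (fun z => h <= D x2 z) a) (norm_le x1 predT a Q1 tQ1).
apply: (@le_trans _ _ (nu x2 * (Num.sqrt (P1 / nu x1) * Num.sqrt (Q2 / nu x2) +
    Num.sqrt (Q1 / nu x1) * Num.sqrt (P2 / nu x2)))).
  by rewrite ler_pM2l// (le_trans split_sum)// lerD.
have s1 : 0 < Num.sqrt (nu x1) by rewrite sqrtr_gt0.
have s2 : 0 < Num.sqrt (nu x2) by rewrite sqrtr_gt0.
have E2 : nu x2 = Num.sqrt (nu x2) ^+ 2 by rewrite sqr_sqrtr// ltW.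
rewrite !sqrtrM ?(ltW P10) ?(ltW P20) ?(ltW Q10) ?(ltW Q20) ?(ltW n2)//.
rewrite !sqrtrV ?(ltW n1) ?(ltW n2)// {1}E2.
rewrite le_eqVlt; apply/orP; left; apply/eqP; field.
by rewrite !gt_eqF.
Qed.

Lemma finite_heat_gaussian (A gamma delta T1 t p : R) (T2 : \bar R) (x1 x2 : T)
    (f1 f2 : R -> R) :
  let alpha := Num.min (2 * gamma)^-1 (64 * delta)^-1 in
  let beta : int := Num.ceil (ln 2 / ln gamma) in
  nonneg_profile f1 -> nonneg_profile f2 ->
  (forall s : R, 0 < s -> nu x1 * u x1 s x1 <= (f1 s)^-1) ->
  (forall s : R, 0 < s -> nu x2 * u x2 s x2 <= (f2 s)^-1) ->
  regular A gamma T1 T2 f1 -> regular A gamma T1 T2 f2 ->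
  (forall s : R, T1 <= s -> (s%:E < T2)%E -> f1 s <= A * expR (delta * s)) ->
  (forall s : R, T1 <= s -> (s%:E < T2)%E -> f2 s <= A * expR (delta * s)) ->
  1 <= A -> 1 < gamma -> 1 <= delta -> 0 <= T1 -> 256 <= p ->
  D x1 x2 <= t -> 0 < t -> 8 * alpha ^- 2 * T1 ^+ 2 <= t -> (t%:E < T2)%E ->
  nu x2 * u x1 t x2 <= 4 * A ^ beta * Num.sqrt (nu x2 / nu x1)
    / Num.sqrt (f1 (alpha * t) * f2 (alpha * t))
    * expR (- ((2 * p ^+ 2)^-1 * (D x1 x2 ^+ 2 / t))).
Proof.
move=> alpha beta f1p f2p h1 h2 r1 r2 g1 g2 A1 gam1 del1 T10 p_ge Dt t0 T1t tT2.
have p0 : 0 < p by apply: lt_le_trans p_ge; rewrite ltr0n.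
have alpha0 : 0 < alpha by rewrite lt_min !invr_gt0 !mulr_gt0//; lra.
have alpha1 : alpha <= 1.
  rewrite /alpha ge_min; apply/orP; left; rewrite invf_le1 ?mulr_gt0//; lra.
have at0 : 0 < alpha * t by rewrite mulr_gt0.
have at_t : alpha * t <= t by rewrite ler_piMl// ltW.
set B := A ^ beta; have B0 : 0 < B by rewrite exprz_gt0//; lra.
set X := D x1 x2 ^+ 2 / (p ^+ 2 * t).
have e0 := expR_gt0 (- X).
have tail x f : nonneg_profile f -> (forall s : R, 0 < s -> nu x * u x s x <= (f s)^-1) ->
    regular A gamma T1 T2 f ->
    (forall s : R, T1 <= s -> (s%:E < T2)%E -> f s <= A * expR (delta * s)) ->
    tail_mass x (D x1 x2 / 2) (t / 2) <= 4 * B ^+ 2 * expR (- X) / f (alpha * t)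
    /\ total_mass x (t / 2) <= (f (alpha * t))^-1.
  move=> fp h reg gr.
  have Zf s : 0 < s -> total_mass x s <= (f (2 * s))^-1.
    by move=> s0; rewrite (total_mass_diag x (ltW s0)); apply: h; rewrite mulr_gt0.
  split.
    apply: (gaussian_tail (Z := total_mass x) (delta := delta) (T1 := T1) (T2 := T2)) => //.
    - by move=> *; exact: tail_mass_step.
    - by move=> *; exact: tail_mass_init.
    - by move=> *; exact: tail_mass_ge0.
    - by move=> *; exact: total_mass_ge0.
    - by move=> *; exact: tail_mass_le.
  have th0 : 0 < t / 2 by rewrite divr_gt0.
  apply: (le_trans (Zf _ th0)); have -> : 2 * (t / 2) = t by field.
  case: fp => _ fpos; rewrite lef_pV2 ?posrE ?fpos//.
  by apply: reg.1 => //; exact: ltW.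
have [tl1 tm1] := tail x1 f1 f1p h1 r1 g1.
have [tl2 tm2] := tail x2 f2 f2p h2 r2 g2.
have p1 : 0 < f1 (alpha * t) by case: f1p => _; exact.
have p2 : 0 < f2 (alpha * t) by case: f2p => _; exact.
move: (f1 (alpha * t)) (f2 (alpha * t)) p1 p2 tl1 tm1 tl2 tm2.
move=> v1 v2 p1 p2 tl1 tm1 tl2 tm2.
have P0 v : 0 < v -> 0 < 4 * B ^+ 2 * expR (- X) / v.
  by move=> v0; rewrite divr_gt0// !mulr_gt0// exprn_gt0.
have := heat_off_diagonal t0 (P0 _ p1) (P0 _ p2) _ _ tl1 tl2 tm1 tm2.
rewrite !invr_gt0 => /(_ p1 p2) /le_trans; apply.
have sP v : 0 < v -> Num.sqrt (4 * B ^+ 2 * expR (- X) / v) =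
    2 * B * expR (- X / 2) / Num.sqrt v.
  move=> v0; have -> : 4 * B ^+ 2 * expR (- X) = (2 * B * expR (- X / 2)) ^+ 2.
    have -> : expR (- X) = expR (- X / 2) ^+ 2.
      by rewrite expr2 -expRD; congr expR; field.
    by ring.
  rewrite sqrtrM ?sqr_ge0// sqrtrV ?(ltW v0)// sqrtr_sqr ger0_norm//.
  by rewrite ltW// !mulr_gt0// expR_gt0.
have -> : (2 * p ^+ 2)^-1 * (D x1 x2 ^+ 2 / t) = X / 2.
  by rewrite /X; field; rewrite !gt_eqF.
rewrite !sP// !sqrtrV ?(ltW p1) ?(ltW p2)// (sqrtrM v2 (ltW p1)).
have s1 : 0 < Num.sqrt v1 by rewrite sqrtr_gt0.
have s2 : 0 < Num.sqrt v2 by rewrite sqrtr_gt0.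
rewrite -[- (X / 2)]mulNr le_eqVlt; apply/orP; left; apply/eqP; field.
by rewrite !gt_eqF.
Qed.

End FiniteHeat.

(** * The generator of the walk *)

Section Generator.
Context {R : realType} {V : choiceType}.

(** Passing to a finite part of the graph can only decrease a sum of nonnegative
terms over the vertices. *)
Lemma le_fsum_codom (T : finType) (e : T -> V) (h : V -> R) (A : set V) :
  injective e -> (forall y, 0 <= h y) -> finite_set A ->
  (forall y, ~ A y -> h y = 0) ->
  \sum_(z : T) h (e z) <= \sum_(y \in [set: V]) h y.
Proof.
move=> e_inj h0 fA hA.
have uc : uniq (codom e) by rewrite map_inj_uniq ?enum_uniq.
have -> : \sum_(z : T) h (e z) = \sum_(y \in [set` codom e]) h y.
  by rewrite -fsbig_seq// big_map big_enum.
pose B := A `|` [set` codom e].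
have fB : finite_set B by rewrite finite_setU.
rewrite -(@fsbig_widen _ _ _ _ B setT)//; last first.
  by move=> y [_ nB] /=; apply: hA => Ay; apply: nB; left.
rewrite (fsbigID [set` codom e])//= -[leLHS]addr0.
have -> : B `&` [set` codom e] = [set` codom e].
  by apply/seteqP; split => y //= => [[]|] //; split => //; right.
by rewrite lerD2l; apply: fsumr_ge0 => y _; exact: h0.
Qed.

Variables (E : rel V) (mu : V -> V -> R) (nu : V -> R).
Hypothesis lf : locally_finite E.
Hypothesis ew : edge_weight E mu.
Hypothesis nu_gt0 : forall x, 0 < nu x.

Let mu0 x y : ~ [set y | E x y] y -> mu x y = 0.
Proof. by case: ew => _ _ h /= /negP; exact: h. Qed.

Lemma edge_weight_ge0 x y : 0 <= mu x y.
Proof.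
case: ew => _ pos zero; case: (boolP (E x y)) => [/pos/ltW//|/zero ->].
exact: lexx.
Qed.

Lemma qmat_offdiag x y : x != y -> qmat (generator mu nu) x y = mu x y / nu x.
Proof.
move=> xy; rewrite /qmat /generator mulrC; congr (_ / _).
rewrite -(@fsbig_widen _ _ _ _ [set y] setT)//; last first.
  move=> z [_ /= zy]; rewrite (negbTE xy) subr0.
  by case: eqP zy => // _ _; rewrite mul0r.
by rewrite fsbig_set1 eqxx (negbTE xy) subr0 mul1r.
Qed.

Lemma nu_rate x :
  nu x * rate (generator mu nu) x = \sum_(z \in [set: V]) (z != x)%:R * mu x z.
Proof.
rewrite /rate /qmat /generator mulrN mulrA divff ?gt_eqF// mul1r eqxx.
have off y : y \notin fset_set [set y | E x y] -> mu x y = 0.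
  by rewrite in_fset_set// => /negP h; apply: mu0 => /mem_set.
rewrite (fsbigTE (fset_set [set y | E x y])); last first.
  by move=> y /off ->; rewrite mulr0.
rewrite (fsbigTE (fset_set [set y | E x y])); last first.
  by move=> y /off ->; rewrite mulr0.
rewrite -sumrN; apply: eq_bigr => z _; rewrite -mulNr opprB.
by case: eqVneq => _ /=; rewrite ?subrr// subr0.
Qed.

Lemma rate_ge0 x : 0 <= rate (generator mu nu) x.
Proof.
rewrite -(pmulr_rge0 _ (nu_gt0 x)) nu_rate; apply: fsumr_ge0 => z _.
by rewrite mulr_ge0// edge_weight_ge0.
Qed.

Lemma jump_prob_ge0 x y : 0 <= jump_prob (generator mu nu) x y.
Proof.
rewrite /jump_prob; case: ifP => // _; case: eqVneq => // xy.
by rewrite qmat_offdiag// divr_ge0 ?rate_ge0// divr_ge0 ?edge_weight_ge0// ltW.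
Qed.

(** This also covers the vertices of rate 0, at which [jump_prob] is a Dirac mass:
no edge then leads to another vertex. *)
Lemma rate_jump_prob x y : rate (generator mu nu) x * jump_prob (generator mu nu) x y =
  (if x == y then 0 else mu x y) / nu x.
Proof.
have r_eq0 : rate (generator mu nu) x = 0 -> x != y -> mu x y = 0.
  move=> r0 xy; apply/eqP; rewrite eq_le edge_weight_ge0 andbT.
  have := nu_rate x; rewrite r0 mulr0 => ->.
  have := @le_fsum_codom unit (fun=> y) (fun z => (z != x)%:R * mu x z)
    [set y | E x y].
  rewrite big_const card_unit /= addr0 eq_sym xy mul1r; apply.
  - by case; case.
  - by move=> z; rewrite mulr_ge0// edge_weight_ge0.
  - exact: lf.
  - by move=> z /mu0 ->; rewrite mulr0.
rewrite /jump_prob; case: (eqVneq (rate _ x) 0) => [r0|rN0].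
  by rewrite r0 mul0r; case: eqVneq => [|xy]; rewrite ?mul0r// r_eq0// mul0r.
case: eqVneq => [|xy]; first by rewrite mulr0 mul0r.
by rewrite mulrC divfK// qmat_offdiag.
Qed.

Lemma conductance_row_le (T : finType) (e : T -> V) (y : T) : injective e ->
  \sum_z (if y == z then 0 else mu (e y) (e z)) <=
  nu (e y) * rate (generator mu nu) (e y).
Proof.
move=> e_inj; rewrite nu_rate.
apply: le_trans (@le_fsum_codom T e (fun z => (z != e y)%:R * mu (e y) z)
  [set z | E (e y) z] e_inj _ _ _).
- apply: ler_sum => z _; rewrite (inj_eq e_inj) [z == y]eq_sym.
  by case: eqVneq => _ /=; rewrite ?mul0r ?mul1r.
- by move=> z; rewrite mulr_ge0// edge_weight_ge0.
- exact: lf.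
- by move=> z /mu0 ->; rewrite mulr0.
Qed.

Lemma adapted_row_le (D : V -> V -> R) (T : finType) (e : T -> V) (y : T) :
  adapted_metric E mu nu D -> injective e ->
  \sum_z (if y == z then 0 else mu (e y) (e z)) * D (e y) (e z) ^+ 2 <= nu (e y).
Proof.
move=> [_ adD _] e_inj; have := adD (e y).
rewrite mulrC ler_pdivrMr// mul1r; apply: le_trans.
apply: le_trans (@le_fsum_codom T e (fun z => D (e y) z ^+ 2 * mu (e y) z)
  [set z | E (e y) z] e_inj _ _ _).
- apply: ler_sum => z _; rewrite mulrC; case: eqVneq => // _.
  by rewrite mulr0 mulr_ge0 ?sqr_ge0// edge_weight_ge0.
- by move=> z; rewrite mulr_ge0 ?sqr_ge0// edge_weight_ge0.
- exact: lf.
- by move=> z /mu0 ->; rewrite mulr0.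
Qed.

End Generator.

(** * From finite sets to the whole graph *)

Section KilledChain.
Context {R : realType} {V : choiceType}.
Variables (E : rel V) (mu : V -> V -> R) (nu : V -> R) (D : V -> V -> R).
Hypothesis lf : locally_finite E.
Hypothesis ew : edge_weight E mu.
Hypothesis nu_gt0 : forall x, 0 < nu x.
Hypothesis adD : adapted_metric E mu nu D.
Context {d : measure_display} {Om : measurableType d}.
Variable P : V -> probability Om R.
Variables (Y : nat -> Om -> V) (S : nat -> Om -> \bar R).
Hypothesis mY : forall n y, measurable (Y n @^-1` [set y]).
Hypothesis mS : forall n, measurable_fun [set: Om] (S n).
Hypothesis S_gt0 : forall n w, (0 < S n w)%E.

Let L := generator mu nu.

Hypothesis law : forall x n (y : nat -> V) (s : nat -> R), (forall k, 0 <= s k) ->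
  P x [set w | forall k, (k <= n)%N -> Y k w = y k /\ ((s k)%:E < S k w)%E]
  = ((y 0%N == x)%:R * \prod_(k < n) jump_prob L (y k) (y k.+1)
     * \prod_(k < n.+1) expR (- (rate L (y k) * s k)))%:E.

Section FiniteDomain.
Variables (T : finType) (e : T -> V).
Hypothesis e_inj : injective e.

Let r (y : T) : R := rate L (e y).
Let c (y z : T) : R := if y == z then 0 else mu (e y) (e z).
Let F (x : T) (t : R) (y : T) : R := killed_prob (P (e x)) Y S e t y.
Let u (x : T) (t : R) (y : T) : R := (nu (e y))^-1 * F x (Num.max t 0) y.
(* Matrix of the generator killed outside T: the diagonal carries the full jump
   rate, including the jumps that leave T. *)
Let M (z y : T) : R := c z y / nu (e z) - (z == y)%:R * r y.

Let rate0 y : 0 <= rate L y. Proof. exact: rate_ge0 lf ew nu_gt0 y. Qed.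
Let jump0 y z : 0 <= jump_prob L y z.
Proof. exact: jump_prob_ge0 lf ew nu_gt0 y z. Qed.

Let F_le1 x t y : `|F x t y| <= 1.
Proof. by rewrite ger0_norm ?killed_prob_ge0//; exact: killed_prob_le1. Qed.

Let F_M x t y : \sum_z F x t z * M z y =
  \sum_z F x t z * (rate L (e z) * jump_prob L (e z) (e y)) - r y * F x t y.
Proof.
rewrite /M; under eq_bigr do rewrite mulrBr; rewrite sumrB; congr (_ - _).
  apply: eq_bigr => z _; rewrite (rate_jump_prob lf ew nu_gt0) /c (inj_eq e_inj).
  by [].
rewrite (bigD1 y)//= eqxx mul1r mulrC big1 ?addr0// => z zy.
by rewrite (negbTE zy) mul0r mulr0.
Qed.

Let F_incr x : exists C : R, forall (t h : R) y, 0 <= t -> 0 <= h ->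
  `|F x (t + h) y - F x t y - h * (\sum_z F x t z * M z y)| <= C * h ^+ 2.
Proof.
have [C H] := killed_prob_increment mY mS S_gt0 rate0 jump0 (law (e x)) e_inj.
by exists C => t h y t0 h0; rewrite F_M; exact: H.
Qed.

Let u_cont x y : continuous (fun t : R => u x t y).
Proof.
have [C H] := F_incr x => t; apply: cvgMr.
exact: (@increments_continuous R T (F x) M C (F_le1 x) H y t).
Qed.

Let u_derive x (t : R) y : 0 < t ->
  is_derive t 1 (fun t : R => u x t y)
    ((nu (e y))^-1 * (\sum_z c y z * u x t z) - r y * u x t y).
Proof.
move=> t0; have [C H] := F_incr x.
apply: is_derive_eq (is_derive_scale _ (increments_is_derive (F_le1 x) H y t0)) _.
rewrite /M; under eq_bigr do rewrite mulrBr; rewrite sumrB mulrBr; congr (_ * _ - _).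
  apply: eq_bigr => z _; rewrite /u /c; case: ew => sym _ _.
  by rewrite eq_sym sym; ring.
rewrite (bigD1 y)//= eqxx mul1r big1 ?addr0.
  by rewrite /u; ring.
by move=> z zy; rewrite (negbTE zy) mul0r mulr0.
Qed.

Let u_init x y : u x 0 y = (x == y)%:R / nu (e x).
Proof.
rewrite /u /F maxxx (killed_prob0 S_gt0 (law (e x)) e_inj y (erefl _)).
by rewrite eq_sym; case: eqVneq => [->|]; rewrite ?mul0r ?mulr0// mulrC.
Qed.

(** The killed walk satisfies the hypotheses of [finite_heat_gaussian], with a
bound that does not depend on the finite set. *)
Lemma killed_gaussian (A gamma delta T1 t p : R) (T2 : \bar R) (x1 x2 : T)
    (f1 f2 : R -> R) :
  let alpha := Num.min (2 * gamma)^-1 (64 * delta)^-1 in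
  let beta : int := Num.ceil (ln 2 / ln gamma) in
  nonneg_profile f1 -> nonneg_profile f2 ->
  (forall s : R, 0 < s -> killed_prob (P (e x1)) Y S e s x1 <= (f1 s)^-1) ->
  (forall s : R, 0 < s -> killed_prob (P (e x2)) Y S e s x2 <= (f2 s)^-1) ->
  regular A gamma T1 T2 f1 -> regular A gamma T1 T2 f2 ->
  (forall s : R, T1 <= s -> (s%:E < T2)%E -> f1 s <= A * expR (delta * s)) ->
  (forall s : R, T1 <= s -> (s%:E < T2)%E -> f2 s <= A * expR (delta * s)) ->
  1 <= A -> 1 < gamma -> 1 <= delta -> 0 <= T1 -> 256 <= p ->
  D (e x1) (e x2) <= t -> 0 < t -> 8 * alpha ^- 2 * T1 ^+ 2 <= t -> (t%:E < T2)%E ->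
  killed_prob (P (e x1)) Y S e t x2 <=
    4 * A ^ beta * Num.sqrt (nu (e x2) / nu (e x1))
    / Num.sqrt (f1 (alpha * t) * f2 (alpha * t))
    * expR (- ((2 * p ^+ 2)^-1 * (D (e x1) (e x2) ^+ 2 / t))).
Proof.
move=> alpha beta f1p f2p h1 h2 r1 r2 g1 g2 A1 gam1 del1 T10 p_ge Dt t0 T1t tT2.
have uE x (s : R) y : 0 < s -> killed_prob (P (e x)) Y S e s y = nu (e y) * u x s y.
  by move=> s0; rewrite /u max_l ?ltW// mulrA divff ?mul1r// gt_eqF.
rewrite uE//; have [[D0 Drefl Dsym Dtri] _ D1] := adD; have [mu_sym _ mu_zero] := ew.
apply: (@finite_heat_gaussian R T (nu \o e) r c (fun y z => D (e y) (e z)) u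
  _ _ _ _ _ _ _ _ _ _ _ _ _ _ A gamma delta T1 t p T2 x1 x2 f1 f2) => //.
- by move=> y /=.
- by move=> y z; rewrite /c; case: ifP => // _; exact: edge_weight_ge0 ew _ _.
- by move=> y z; rewrite /c eq_sym mu_sym.
- by move=> y; exact: (@conductance_row_le R V E mu nu lf ew nu_gt0 T e y e_inj).
- by move=> y; exact: (@adapted_row_le R V E mu nu lf ew nu_gt0 D T e y adD e_inj).
- move=> y z; rewrite /c; case: ifP => [_|_ m0]; first by rewrite ltxx.
  by apply: D1; apply/negPn/negP => /mu_zero m; rewrite m ltxx in m0.
- by move=> y; apply/Drefl.
- move=> x s y; rewrite /u mulr_ge0 ?killed_prob_ge0// invr_ge0 ltW//.
- by move=> s s0; rewrite -uE//; exact: h1.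
- by move=> s s0; rewrite -uE//; exact: h2.
Qed.

End FiniteDomain.

End KilledChain.

Section Exhaustion.
Context {R : realType} {V : choiceType}.
Context {d : measure_display} {Om : measurableType d}.
Variables (Y : nat -> Om -> V) (S : nat -> Om -> \bar R).

(** The killed event does not depend on the finite set except through the
requirement that the visited positions belong to it; this makes it monotone in
the set. *)
Lemma killed_atP (T : finType) (e : T -> V) (t : R) (z : T) w :
  killed_at Y S e t z w <-> exists n, [/\ Y n w = e z, sojourn S n t w &
    forall k, (k < n)%N -> exists i, Y k w = e i].
Proof.
split=> [[q _ [fq sq]]|[n [Yn sn Yk]]].
  exists (size q); split => //; first by rewrite fq// itinerary_last.
  by move=> k kq; exists (nth z q k); rewrite fq// ltnW.
pose g k := odflt z [pick i | Y k w == e i].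
have eg k : (k < n)%N -> Y k w = e (g k).
  move=> /Yk [i Yi]; rewrite /g; case: pickP => [j /eqP//|/(_ i)].
  by rewrite Yi eqxx.
exists (mkseq g n) => //; rewrite /visit size_mkseq; split => // k.
rewrite leq_eqVlt /itinerary => /predU1P[->|kn].
  by rewrite nth_default ?size_mkseq.
by rewrite nth_mkseq// eg.
Qed.

Variables (E : rel V) (x1 x2 : V).

Fixpoint graph_ball (n : nat) : set V :=
  if n is m.+1 then graph_ball m `|` \bigcup_(y in graph_ball m) [set z | E y z]
  else [set x1; x2].

Lemma graph_ball_finite n : locally_finite E -> finite_set (graph_ball n).
Proof.
move=> lf; elim: n => [|n ih] /=; first exact: finite_set2.
by rewrite finite_setU; split => //; apply: bigcup_finite.
Qed.

Lemma graph_ball_homo m n : (m <= n)%N -> graph_ball m `<=` graph_ball n.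
Proof.
move=> /subnKC <-; elim: (n - m)%N => [|k ih]; first by rewrite addn0.
by rewrite addnS /= => x bx; left; exact: ih.
Qed.

Lemma graph_ball_cover y : connected_graph E -> exists n, graph_ball n y.
Proof.
move=> /(_ x1 y) [q pq <-].
have : graph_ball 0 x1 by left.
elim: q (x1) 0%N pq => [|a q ih] x n /=; first by move=> _ bx; exists n.
move=> /andP[Exa pq] bx; apply: (ih a n.+1 pq) => /=.
by right; exists x.
Qed.

Lemma graph_ball_cover_seq (y : nat -> V) n : connected_graph E ->
  exists m, forall k, (k <= n)%N -> graph_ball m (y k).
Proof.
move=> conn; elim: n => [|n [m H]].
  have [m bm] := graph_ball_cover (y 0%N) conn.
  by exists m => k; rewrite leqn0 => /eqP ->.
have [m' bm'] := graph_ball_cover (y n.+1) conn.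
exists (maxn m m') => k; rewrite leq_eqVlt => /predU1P[->|kn].
  by apply: graph_ball_homo bm'; exact: leq_maxr.
by apply: graph_ball_homo (H k kn); exact: leq_maxl.
Qed.

End Exhaustion.

Theorem theorem1p2 (R : realType) :
  exists C1 theta : R, 0 < C1 /\ 0 < theta /\
  forall (V : choiceType) (E : rel V) (mu : V -> V -> R) (nu : V -> R)
    (D : V -> V -> R),
  symmetric E -> connected_graph E -> locally_finite E ->
  edge_weight E mu -> (forall x, 0 < nu x) ->
  adapted_metric E mu nu D ->
  forall (d : measure_display) (Om : measurableType d)
    (P : V -> probability Om R) (X : R -> Om -> option V),
  minimal_chain (generator mu nu) P X ->
  forall (A gamma delta T1 : R) (T2 : \bar R) (x1 x2 : V) (f1 f2 : R -> R),
  1 <= A -> 1 < gamma -> 1 <= delta -> 0 <= T1 -> (T1%:E < T2)%E ->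
  nonneg_profile f1 -> nonneg_profile f2 ->
  (forall t : R, 0 <= t -> (P x1 [set w | X t w = Some x1] <= (f1 t)%:E^-1)%E) ->
  (forall t : R, 0 <= t -> (P x2 [set w | X t w = Some x2] <= (f2 t)%:E^-1)%E) ->
  regular A gamma T1 T2 f1 -> regular A gamma T1 T2 f2 ->
  (forall t : R, T1 <= t -> (t%:E < T2)%E -> f1 t <= A * expR (delta * t)) ->
  (forall t : R, T1 <= t -> (t%:E < T2)%E -> f2 t <= A * expR (delta * t)) ->
  let alpha := Num.min (2 * gamma)^-1 (64 * delta)^-1 in
  let beta : int := Num.ceil (ln 2 / ln gamma) in
  let T1' := Num.max (8 * alpha ^- 2 * T1 ^+ 2) (D x1 x2) in
  forall t : R, T1' <= t -> (t%:E < T2)%E -> 0 < t ->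
  (P x1 [set w | X t w = Some x2]
    <= (C1 * A ^ beta * Num.sqrt (nu x2 / nu x1)
          / Num.sqrt (f1 (alpha * t) * f2 (alpha * t))
          * expR (- (theta * (D x1 x2 ^+ 2 / t))))%:E)%E.
Proof.
(* The tail bound has exponent - d^2 / (p^2 t), and its square root enters the
   off-diagonal bound; hence theta = 1 / (2 p^2). *)
pose p : R := 256.
have p0 : 0 < p by rewrite /p ltr0n.
exists 4, (2 * p ^+ 2)^-1; split; first exact: ltr0n.
split; first by rewrite invr_gt0 mulr_gt0// exprn_gt0.
move=> V E mu nu D _ conn lf ew nu_gt0 adD d Om P X.
move=> [Y [S [mY mS S_gt0 law XE]]] A gamma delta T1 T2 x1 x2 f1 f2.
move=> A1 gam1 del1 T10 _ f1p f2p on1 on2 r1 r2 g1 g2 alpha beta T1' t.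
rewrite ge_max => /andP[T1t Dt] tT2 t0.
set bound := (X in (_ <= X%:E)%E).
have t_ge0 : 0 <= t := ltW t0.
pose B n : {fset V} := fset_set (graph_ball E x1 x2 n).
have inB n y : graph_ball E x1 x2 n y -> y \in B n.
  by move=> by_; rewrite in_fset_set ?inE//; exact: graph_ball_finite.
have Bin n y : y \in B n -> graph_ball E x1 x2 n y.
  by rewrite in_fset_set; [rewrite inE|exact: graph_ball_finite].
have b1 n : x1 \in B n.
  by apply: inB; apply: (graph_ball_homo (leq0n n)); left.
have b2 n : x2 \in B n.
  by apply: inB; apply: (graph_ball_homo (leq0n n)); right.
pose e n (z : B n) : V := val z.
have e_inj n : injective (e n) by exact: val_inj.
pose z1 n : B n := [` b1 n]%fset.
pose z2 n : B n := [` b2 n]%fset.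
have X_event s y : 0 <= s ->
    [set w | X s w = Some y] = \bigcup_n (Y n @^-1` [set y] `&` sojourn S n s).
  move=> s0; apply/seteqP; split => w /=.
    by move=> /(XE _ _ _ s0) [n [Yn /andP[Sn nS]]]; exists n.
  by move=> [n _ [Yn [Sn nS]]]; apply/(XE _ _ _ s0); exists n; split => //; apply/andP.
have mX s y : 0 <= s -> measurable [set w | X s w = Some y].
  move=> s0; rewrite X_event//; apply: bigcupT_measurable => n.
  by apply: measurableI; [exact: mY|exact: sojourn_measurable].
have mK n s z : measurable (killed_at Y S (e n) s z) by exact: killed_at_measurable.
have K_sub n s z : 0 <= s ->
    killed_at Y S (e n) s z `<=` [set w | X s w = Some (e n z)].
  move=> s0 w /killed_atP [k [Yk sk _]]; rewrite X_event//.
  by exists k.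
have on_diag n x (z : B n) (f : R -> R) : e n z = x -> nonneg_profile f ->
    (forall t : R, 0 <= t -> (P x [set w | X t w = Some x] <= (f t)%:E^-1)%E) ->
    forall s : R, 0 < s -> killed_prob (P (e n z)) Y S (e n) s z <= (f s)^-1.
  move=> <- [_ fpos] on s s0; rewrite -lee_fin -prE//.
  have := on s (ltW s0); rewrite inver gt_eqF ?fpos//; apply: le_trans.
  apply: le_measure; rewrite ?inE//; first by apply: mX; exact: ltW.
  by apply: K_sub; exact: ltW.
have K_bound n : (P x1 (killed_at Y S (e n) t (z2 n)) <= bound%:E)%E.
  rewrite prE// lee_fin.
  apply: (killed_gaussian lf ew nu_gt0 adD mY mS S_gt0 law (e_inj n) (x1 := z1 n)
    (x2 := z2 n) f1p f2p _ _ r1 r2 g1 g2) => //.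
    exact: (on_diag n x1 (z1 n) f1 erefl).
  exact: (on_diag n x2 (z2 n) f2 erefl).
have X_lim : [set w | X t w = Some x2] = \bigcup_n killed_at Y S (e n) t (z2 n).
  apply/seteqP; split => w; last by move=> [n _ Kw]; exact: K_sub Kw.
  rewrite X_event// => -[n _ [Yn sn]].
  have [m Hm] := graph_ball_cover_seq x1 x2 (fun k => Y k w) n conn.
  exists m => //; apply/killed_atP; exists n; split => // k kn.
  by exists [` inB _ _ (Hm k (ltnW kn))]%fset.
have K_homo : nondecreasing_seq (fun n => killed_at Y S (e n) t (z2 n)).
  move=> m n mn; apply/subsetPset => w /killed_atP [k [Yk sk Hk]].
  apply/killed_atP; exists k; split => // j jk; have [i Yi] := Hk j jk.
  have i_in : \val i \in B n.
    by apply: inB; apply: (graph_ball_homo mn); apply: Bin; exact: valP.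
  by exists [` i_in]%fset.
have mKlim : measurable (\bigcup_n killed_at Y S (e n) t (z2 n)).
  by apply: bigcupT_measurable => n; exact: mK.
have cv := nondecreasing_cvg_mu (mu := P x1) (fun n => mK n t (z2 n)) mKlim K_homo.
rewrite X_lim -(cvg_lim _ cv)//; apply: lime_le.
  by apply/cvg_ex; eexists; exact: cv.
by apply: nearW => n; exact: K_bound.
Qed.
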